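(* Let $1\leq p<\infty$. Let $f\in L'^{\,p}$ with primitive $F\in L^p$. Let $t>0$ and define $v(x,t)=v_t(x)=f\ast\Theta_t(x)$. (a) Let $q,r\in[1,\infty]$ such that $1/p+1/q=1+1/r$. There is a constant $L_{p,q}$ such that $\|f\ast\Theta_t\|_r\leq L_{p,q}\|f\|'_p\,t^{-(2-1/q)/2}$ for all $t>0$. The estimate is sharp in the sense that if $\psi:(0,\infty)\to(0,\infty)$ such that $\psi(t)=o(t^{-(2-1/q)/2})$ as $t\to0^+$ or $t\to\infty$ then there is $g\in L'^{\,p}$ such that $\|g\ast\Theta_t\|_r/\psi(t)$ is not bounded as $t\to0^+$ or $t\to\infty$. (b) Fix $t>0$. Then $v_t$ cannot be of one sign. (c) For each $t>0$, $\int_{-\infty}^\infty v_t(x)\,dx=0$. (d) For each $t>0$, $\lim_{|x|\to\infty}v_t(x)=0$. (e) Suppose $f$ has compact support in $[-R,R]$. Then $v_t(x)=O\big(|x|^{1/p}e^{-(|x|-R)^2/(4t)}\big)$ for fixed $t>0$ as $|x|\to\infty$. Or, $$|v_t(x)|\leq\begin{cases}M_p\|f\|'_1\,|x|\,e^{-(|x|-R)^2/(4t)}\,t^{-3/2}, & p=1,\ |x|\geq R+\sqrt{2t},\\[2pt] M_p\|f\|'_p\,|x|^{1/p}\,e^{-x^2/(16t)}\,t^{-(1/2+1/p)}, & 1<p<\infty,\ |x|\geq2R,\end{cases}$$ where $$M_p=\begin{cases}\dfrac{1}{4\sqrt\pi}, & p=1,\\[6pt] \dfrac{3^{1/p}(p-1)^{1-1/p}}{2^{1+2/p}\sqrt\pi\,p^{1-1/p}},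 & 1<p<\infty.\end{cases}$$
   Context: All functions are real-valued on $\mathbb{R}$; $L^p=L^p(\mathbb{R})$ is the Lebesgue space with norm $\|\cdot\|_p$ ($1\leq p\leq\infty$); $\mathcal{S}'$ is the space of tempered distributions on $\mathbb{R}$. Integrals that explicitly show the integration variable and differential are Lebesgue integrals. For $1\leq p<\infty$, $L'^{\,p}=\{f\in\mathcal{S}' : f=F' \text{ (distributional derivative) for some } F\in L^p\}$. Each $f\in L'^{\,p}$ has a unique primitive $F\in L^p$ (i.e. $F'=f$), and $\|f\|'_p:=\|F\|_p$. The Gauss–Weierstrass heat kernel is $\Theta_t(x)=\frac{1}{2\sqrt{\pi t}}\exp(-x^2/(4t))$, $t>0$. For $f\in L'^{\,p}$ with primitive $F\in L^p$, the convolution is $f\ast\Theta_t(x)=F\ast\Theta_t'(x)=\int_{-\infty}^\infty F(y)\Theta_t'(x-y)\,dy$, where $\Theta_t'$ is the derivative in $x$.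
   Formalization: In (c), for p>1 v_t need not be Lebesgue integrable (e.g. F(x)=sin(x)(1+x²)^{-s/2}, 1/p<s≤1); so the integral is shown to be 0 as an improper integral for all p, and as a Lebesgue integral whenever v_t is integrable, which is proved for p=1. *)

(* Defs.v *)
From HB Require Import structures.
From mathcomp Require Import all_boot all_order all_algebra.
From mathcomp Require Import all_classical all_reals all_analysis.
Set Implicit Arguments.
Unset Strict Implicit.
Unset Printing Implicit Defensive.
Import Order.TTheory GRing.Theory Num.Theory.
Import numFieldNormedType.Exports.
Local Open Scope classical_set_scope.
Local Open Scope ring_scope.

Section Distributions.
Context {R : realType}.
Notation mu := (@lebesgue_measure R).
Implicit Types (p : \bar R) (phi F : R -> R) (f T : (R -> R) -> R).

Definition Lp_norm p F : \bar R := 'N[mu]_p[EFin \o F].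

Definition smooth phi := forall n x, derivable (derive1n n phi) x 1.

Definition schwartz phi :=
  smooth phi /\
  forall m n : nat, exists C : R, forall x, `|x ^+ m * derive1n n phi x| <= C.

Definition schwartz_cvg (phi_ : nat -> R -> R) phi :=
  forall (m n : nat) (e : R), 0 < e ->
    \forall k \near \oo,
      forall x, `|x ^+ m * (derive1n n (phi_ k) x - derive1n n phi x)| <= e.

(* A distribution is a functional on all of [R -> R], of which only the values
   at Schwartz functions are meaningful.  The Schwartz space being metrizable,
   sequential continuity is continuity. *)
Definition tempered T :=
  (forall (a : R) phi psi, schwartz phi -> schwartz psi ->
     T (fun x => a * phi x + psi x) = a * T phi + T psi) /\
  (forall (phi_ : nat -> R -> R) phi, (forall k, schwartz (phi_ k)) -> schwartz phi ->
     schwartz_cvg phi_ phi -> T (phi_ k) @[k --> \oo] --> T phi).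

Definition dist_of_fun F : (R -> R) -> R :=
  fun phi => (\int[mu]_x (F x * phi x))%R.

Definition dist_deriv T : (R -> R) -> R := fun phi => - T (derive1 phi).

(* [F] is any representative of the almost-everywhere class of the primitive,
   which is unique in L^p; hence ||f||'_p is [Lp_norm p F]. *)
Definition primitive p f F :=
  F \in Lfun mu p /\
  forall phi, schwartz phi -> f phi = dist_deriv (dist_of_fun F) phi.

Definition Lprime p f := tempered f /\ exists F, primitive p f F.

Definition vanishes_on f (U : set R) :=
  forall phi, smooth phi ->
    compact (closure [set x | phi x != 0]) ->
    closure [set x | phi x != 0] `<=` U ->
    f phi = 0.

Definition dist_support f : set R :=
  [set x | forall U : set R, open U -> U x -> ~ vanishes_on f U].

Definition heat_kernel (t x : R) : R :=
  (2 * Num.sqrt (pi * t))^-1 * expR (- x ^+ 2 / (4 * t)).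

(* The convolution of the heat kernel with the distribution of primitive [F]. *)
Definition heat_conv F (t x : R) : R :=
  (\int[mu]_y (F y * derive1 (heat_kernel t) (x - y)))%R.

(* The zero function is not considered to be of one sign. *)
Definition of_one_sign (v : R -> R) :=
  (exists x, v x != 0) /\ ((forall x, 0 <= v x) \/ (forall x, v x <= 0)).

(* The [=o_] and [=O_] notations need a canonical filter structure, which
   [pinfty_nbhs] and [ninfty_nbhs] do not have. *)
Definition littleo_near (H : set_system R) (h g : R -> R) :=
  forall e, 0 < e -> \forall x \near H, `|h x| <= e * `|g x|.

Definition bigO_near (H : set_system R) (h g : R -> R) :=
  exists C, \forall x \near H, `|h x| <= C * `|g x|.

Definition unbounded_near (H : set_system R) (h : R -> \bar R) :=
  ~ exists M : R, \forall t \near H, (h t <= M%:E)%E.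

Definition M_const (p : R) : R :=
  if p == 1 then (4 * Num.sqrt pi)^-1
  else 3 `^ p^-1 * (p - 1) `^ (1 - p^-1) /
       (2 `^ (1 + 2 / p) * Num.sqrt pi * p `^ (1 - p^-1)).

End Distributions.

(* Main.v *)
(** Everything follows from v_t = F * Theta_t'.

    (a) Since a <= l^(1-p) a^p + l for all l > 0, integrating against
    |Theta_t'(x - .)| and optimising l bounds |v_t| both pointwise and in L^p;
    L^r lies between L^p and L^oo.  For sharpness, take
    G = (sum_k 2^-k s_k^(-1/2) 1_[-sqrt s_k, -sqrt s_k / 2])^(1/p): it lies in
    L^p, and the L^r norm over ]0, sqrt s_k[ of the solution at time s_k is at
    least a multiple of 2^(-k/p) times the extremal rate, while the s_k can be
    chosen so that psi(s_k) <= 4^-k rate(s_k).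

    (b), (c), (d) w = F * Theta_t is a primitive of the continuous function
    v_t, and both tend to 0 at infinity.  Hence the integral of v_t over [a, b]
    is w(b) - w(a) -> 0, and a monotone w would vanish identically.

    (e) Testing f with the difference of two translates of a smooth step
    function gives a difference of two mollified means of F.  So F takes equal
    values at Lebesgue points of an interval off the support of f; as F is in
    L^p it vanishes almost everywhere off [-R, R].  For p = 1 the bound comes
    from u e^(-u^2 / 4t) being decreasing for u >= sqrt (2t); for p > 1 it is
    Hoelder's inequality on [-R, R], where |x - y|^q is split as
    |x - y|^(q-1) |x - y| with |x - y| <= 3/2 |x|, the remaining factor making
    the Gaussian integrable in closed form. *)

Require Import Defs.
From HB Require Import structures.
From mathcomp Require Import all_boot all_order all_algebra.
From mathcomp Require Import all_classical all_reals all_analysis.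
From mathcomp Require Import measurable_realfun ess_sup_inf.
From mathcomp Require Import ring lra.
Set Implicit Arguments.
Unset Strict Implicit.
Unset Printing Implicit Defensive.
Import Order.TTheory GRing.Theory Num.Theory.
Import numFieldNormedType.Exports.
Local Open Scope classical_set_scope.
Local Open Scope ring_scope.

(** * Convolution of an L^p function with a bounded integrable kernel *)

(** Two numbers attached to the kernel k = Theta_t' carry part (a): a bound A of its L^1 norm, of
    order t^(-1/2), and a bound B of its sup norm, of order t^(-1). With N = ||F||_p they give sup
    |v_t| <= 2 N A^(1-1/p) B^(1/p) and ||v_t||_p <= 2 A N, hence in L^r the factor A^(1/q)
    B^(1-1/q), which is a multiple of t^(-(2-1/q)/2). The factor 2 is the price of linearising the
    power.

    The humps live at the diffusion scale sqrt s: there |Theta_s'| is of order 1/s on a set of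
    length of order sqrt s, so a hump of height s^(-1/(2p)) makes |v| of order s^(-1/2-1/(2p)) on a
    set of length sqrt s, and the L^r norm of that is again the rate. One G has to serve infinitely
    many times at once; hence the weights 2^-k, which keep G in L^p and which the gap 4^-k between
    psi and the rate has to beat.

    In (e), F is an almost everywhere class and f is known only through test functions, so values of
    F can be compared at Lebesgue points only. *)

Section weighted.
Context {R : realType}.
Notation mu := (@lebesgue_measure R).
Implicit Types (F h : R -> R) (p : R).

Lemma le_powR_split (p a l : R) : 1 <= p -> 0 <= a -> 0 < l ->
  a <= l `^ (1 - p) * a `^ p + l.
Proof.
move=> p1 a0 l0; have [al|la] := leP a l.
  by rewrite (le_trans al)// lerDr mulr_ge0 ?powR_ge0.
have a_gt0 : 0 < a by apply: lt_trans la.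
rewrite (@le_trans _ _ (l `^ (1 - p) * a `^ p))//; last by rewrite lerDl ltW.
have -> : a `^ p = a * a `^ (p - 1) by rewrite mulr_powRB1// (lt_le_trans ltr01).
rewrite mulrCA ler_peMr// -opprB powRN mulrC ler_pdivlMr ?powR_gt0// mul1r.
by rewrite ge0_ler_powR ?nnegrE ?subr_ge0// ltW.
Qed.

(** Hoelder's inequality for the measure |h(y)| dy, with a factor 2: integrating the splitting
    bounds the left side by l^(1-p) J + l A for every l > 0. *)
Lemma weighted_integral_le p F h (A J : R) : 1 <= p -> 0 < A -> 0 <= J ->
  measurable_fun setT F -> measurable_fun setT h ->
  (\int[mu]_y (`|h y|)%:E <= A%:E)%E ->
  (\int[mu]_y (`|F y| `^ p * `|h y|)%:E <= J%:E)%E ->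
  (\int[mu]_y (`|F y * h y|)%:E <= (2 * A `^ (1 - p^-1) * J `^ p^-1)%:E)%E.
Proof.
move=> p1 A0 J0 mF mh hA hJ.
have p0 : 0 < p by apply: lt_le_trans p1.
have mnh : measurable_fun setT (fun y => `|h y|) by exact: measurableT_comp.
have mFp : measurable_fun setT (fun y => `|F y| `^ p).
  by apply: (measurableT_comp (measurable_powR p)); exact: measurableT_comp.
have main (l : R) : 0 < l ->
    (\int[mu]_y (`|F y * h y|)%:E <= (l `^ (1 - p) * J + l * A)%:E)%E.
  move=> l0.
  apply: (@le_trans _ _ (\int[mu]_y ((l `^ (1 - p))%:E *
     (`|F y| `^ p * `|h y|)%:E + l%:E * `|h y|%:E))%E).
    apply: ge0_le_integral => //.
    - apply/measurable_EFinP; apply: measurableT_comp => //.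
      exact: measurable_funM.
    - apply: emeasurable_funD; apply: emeasurable_funM => //;
        apply/measurable_EFinP => //.
      exact: measurable_funM.
    - move=> y _; rewrite -!EFinM -EFinD lee_fin normrM mulrA -mulrDl.
      by rewrite ler_wpM2r// le_powR_split.
  rewrite ge0_integralD//; first last.
  - by apply: emeasurable_funM => //; exact/measurable_EFinP.
  - by move=> y _; rewrite -EFinM lee_fin mulr_ge0// ltW.
  - apply: emeasurable_funM => //; apply/measurable_EFinP.
    exact: measurable_funM.
  - by move=> y _; rewrite -EFinM lee_fin !mulr_ge0// powR_ge0.
  rewrite !ge0_integralZl_EFin//; first last.
  - exact: powR_ge0.
  - by apply/measurable_EFinP; exact: measurable_funM.
  - exact: ltW.
  - exact/measurable_EFinP.
  rewrite EFinD !EFinM leeD// lee_pmul2l// ?lte_fin// ?powR_gt0//.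
(* The optimal l vanishes with J, so in this case l = e / A with e arbitrarily small is used
   instead. *)
have [J00|Jneq0] := eqVneq J 0.
  rewrite {1}J00 powR0 ?invr_eq0 ?gt_eqF// mulr0; apply/lee_addgt0Pr => e e0.
  rewrite add0e (le_trans (main (e / A) _)) ?divr_gt0//.
  by rewrite J00 mulr0 add0r divfK ?gt_eqF.
have {Jneq0}Jgt0 : 0 < J by rewrite lt_neqAle eq_sym Jneq0.
(* This l satisfies l^p = J / A, which makes the two terms equal; whence the factor 2. *)
have l0 : 0 < (J / A) `^ p^-1 by rewrite powR_gt0 ?divr_gt0.
apply: (le_trans (main _ l0)); rewrite lee_fin.
set l := _ `^ _ in l0 *.
have lp : l `^ p = J / A by rewrite /l -powRrM mulVf ?gt_eqF// powRr1 ?divr_ge0// ltW.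
rewrite powRB; last by rewrite (gt_eqF l0) implybT.
rewrite powRr1 ?(ltW l0)// lp.
have -> : l / (J / A) * J + l * A = 2 * l * A by field; rewrite !gt_eqF.
rewrite -!mulrA ler_pM2l//.
have -> // : l * A = A `^ (1 - p^-1) * J `^ p^-1.
  rewrite /l powRM ?(ltW Jgt0) ?invr_ge0 ?(ltW A0)// -[A^-1]powR_inv1 ?(ltW A0)//.
  rewrite -powRrM mulN1r -mulrA -{2}[A]powRr1 ?(ltW A0)//.
  rewrite -powRD; last by rewrite (gt_eqF A0) implybT.
  by rewrite mulrC [- _ + _]addrC.
Qed.

Lemma weighted_integral_le_sup p F h (A B N : R) : 1 <= p -> 0 < A -> 0 <= B ->
  0 <= N -> measurable_fun setT F -> measurable_fun setT h ->
  (\int[mu]_y (`|F y| `^ p)%:E <= (N `^ p)%:E)%E ->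
  (\int[mu]_y (`|h y|)%:E <= A%:E)%E -> (forall y, `|h y| <= B) ->
  (\int[mu]_y (`|F y * h y|)%:E
    <= (2 * N * A `^ (1 - p^-1) * B `^ p^-1)%:E)%E.
Proof.
move=> p1 A0 B0 N0 mF mh hN hA hB.
have p0 : 0 < p by apply: lt_le_trans p1.
have mFp : measurable_fun setT (fun y => `|F y| `^ p).
  by apply: (measurableT_comp (measurable_powR p)); exact: measurableT_comp.
apply: (le_trans (weighted_integral_le (J := B * N `^ p) p1 A0 _ mF mh hA _)).
- by rewrite mulr_ge0// powR_ge0.
- apply: (@le_trans _ _ (\int[mu]_y (B%:E * (`|F y| `^ p)%:E))%E).
    apply: ge0_le_integral => //.
    + apply/measurable_EFinP; apply: measurable_funM => //.
      exact: measurableT_comp.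
    + by apply: emeasurable_funM => //; exact/measurable_EFinP.
    + by move=> y _; rewrite -EFinM lee_fin mulrC ler_wpM2r// powR_ge0.
  rewrite ge0_integralZl_EFin//; last exact/measurable_EFinP.
  by rewrite EFinM lee_wpmul2l// lee_fin.
- rewrite lee_fin powRM// ?powR_ge0// -powRrM mulfV ?gt_eqF// powRr1//.
  by rewrite le_eqVlt; apply/orP; left; apply/eqP; ring.
Qed.

Lemma Lfun_integral_powR p F : 1 <= p -> F \in Lfun mu p%:E ->
  measurable_fun setT F /\
  (\int[mu]_y (`|F y| `^ p)%:E = (fine (Lp_norm p%:E F) `^ p)%:E)%E.
Proof.
move=> p1; rewrite inE => /andP[mF fF]; split; first by move: mF; rewrite inE.
have p0 : p != 0 by rewrite gt_eqF// (lt_le_trans ltr01).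
move/set_mem: fF; rewrite /finite_norm/= => fF.
have Nfin : Lp_norm p%:E F \is a fin_num.
  by rewrite ge0_fin_numE ?Lnorm_ge0.
by rewrite -poweR_EFin fineK// poweR_Lnorm.
Qed.

Lemma Lfun_norm_fin p F : 1 <= p -> F \in Lfun mu p%:E ->
  Lp_norm p%:E F \is a fin_num.
Proof.
move=> p1; rewrite inE => /andP[mF] /set_mem/= fF.
by rewrite ge0_fin_numE ?Lnorm_ge0.
Qed.

Lemma LfunP p F : 1 <= p -> measurable_fun setT F ->
  (\int[mu]_y (`|F y| `^ p)%:E < +oo)%E -> F \in Lfun mu p%:E.
Proof.
move=> p1 mF iF; rewrite inE; apply/andP; split; apply/mem_set => //=.
by rewrite /finite_norm unlock poweR_lty.
Qed.

(** [heat_conv F t] unfolds to [conv F (derive1 (heat_kernel t))], so results on [conv] apply to it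
    as they stand; the kernel [heat_kernel t] itself will give the primitive of v_t. *)
Definition conv F (k : R -> R) (x : R) : R := (\int[mu]_y (F y * k (x - y)))%R.

(** The integral bound in y is used at a fixed point x, the one in x after an exchange of
    integrals. *)
Record kernel_bound (k : R -> R) (A B : R) : Prop := KernelBound {
  kernel_cont : continuous k;
  kernel_A_gt0 : 0 < A;
  kernel_B_ge0 : 0 <= B;
  kernel_le : forall x, `|k x| <= B;
  kernel_intl : forall x, (\int[mu]_y (`|k (x - y)|)%:E <= A%:E)%E;
  kernel_intr : forall y, (\int[mu]_x (`|k (x - y)|)%:E <= A%:E)%E }.

Lemma measurable_shift (k : R -> R) (x : R) : continuous k ->
  measurable_fun setT (fun y : R => k (x - y)).
Proof.
move=> ck; apply: measurableT_comp; first exact: continuous_measurable_fun.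
exact: measurable_funB.
Qed.

Lemma measurable_sub2 (k : R -> R) : continuous k ->
  measurable_fun setT (fun z : R * R => k (z.1 - z.2)).
Proof.
move=> ck; apply: measurableT_comp; first exact: continuous_measurable_fun.
exact: measurable_funB.
Qed.

Lemma normr_conv_le F (k : R -> R) (x C : R) :
  measurable_fun setT F -> measurable_fun setT (fun y : R => k (x - y)) ->
  (\int[mu]_y (`|F y * k (x - y)|)%:E <= C%:E)%E ->
  mu.-integrable setT (fun y => (F y * k (x - y))%:E) /\ `|conv F k x| <= C.
Proof.
move=> mF mk hC.
have mFk : measurable_fun setT (fun y => F y * k (x - y)) by exact: measurable_funM.
have intFk : mu.-integrable setT (fun y => (F y * k (x - y))%:E).
  apply/integrableP; split; first exact/measurable_EFinP.
  by apply: (le_lt_trans hC); rewrite ltry.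
split=> //; rewrite -lee_fin EFin_normr_Rintegral//.
apply: le_trans hC; apply: le_abse_integral => //.
exact/measurable_EFinP.
Qed.

Section conv_Lp.
Variables (p : R) (F k : R -> R) (A B : R).
Hypotheses (p1 : 1 <= p) (FLp : F \in Lfun mu p%:E) (kAB : kernel_bound k A B).
Let N := fine (Lp_norm p%:E F).
Let N0 : 0 <= N. Proof. by rewrite fine_ge0 ?Lnorm_ge0. Qed.
Let p0 : 0 < p. Proof. exact: lt_le_trans p1. Qed.
Let mF : measurable_fun setT F. Proof. by have [] := Lfun_integral_powR p1 FLp. Qed.
Let mFp : measurable_fun setT (fun y => `|F y| `^ p).
Proof.
by apply: (measurableT_comp (measurable_powR p)); exact: measurableT_comp.
Qed.

Lemma conv_sup x : mu.-integrable setT (fun y => (F y * k (x - y))%:E) /\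
  `|conv F k x| <= 2 * N * A `^ (1 - p^-1) * B `^ p^-1.
Proof.
case: kAB => ck A0 B0 kB kA _.
apply: normr_conv_le => //; first exact: measurable_shift.
apply: weighted_integral_le_sup => //; first exact: measurable_shift.
by rewrite (Lfun_integral_powR p1 FLp).2.
Qed.

(** The convolution of |F|^p with |k|, finite because |k| <= B: it is the J of
    [weighted_integral_le] at the point x. *)
Definition conv_weight x := fine (\int[mu]_y (`|F y| `^ p * `|k (x - y)|)%:E)%E.

Lemma conv_weightE x :
  (\int[mu]_y (`|F y| `^ p * `|k (x - y)|)%:E = (conv_weight x)%:E)%E.
Proof.
case: kAB => ck A0 B0 kB kA _.
rewrite /conv_weight fineK// ge0_fin_numE; last first.
  by apply: integral_ge0 => y _; rewrite lee_fin mulr_ge0// powR_ge0.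
apply: (@le_lt_trans _ _ (\int[mu]_y (B%:E * (`|F y| `^ p)%:E))%E).
  apply: ge0_le_integral => //.
  - apply/measurable_EFinP; apply: measurable_funM => //.
    by apply: measurableT_comp => //; exact: measurable_shift.
  - by apply: emeasurable_funM => //; exact/measurable_EFinP.
  - by move=> y _; rewrite -EFinM lee_fin mulrC ler_wpM2r// powR_ge0.
rewrite ge0_integralZl_EFin//; last exact/measurable_EFinP.
by rewrite (Lfun_integral_powR p1 FLp).2 -EFinM ltry.
Qed.

Lemma conv_weight_ge0 x : 0 <= conv_weight x.
Proof.
by rewrite fine_ge0// integral_ge0// => y _; rewrite lee_fin mulr_ge0// powR_ge0.
Qed.

Lemma normr_conv_weight x :
  `|conv F k x| <= 2 * A `^ (1 - p^-1) * conv_weight x `^ p^-1.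
Proof.
case: kAB => ck A0 B0 kB kA _.
apply: (normr_conv_le _ _ _).2 => //; first exact: measurable_shift.
apply: weighted_integral_le => //; first exact: conv_weight_ge0.
  exact: measurable_shift.
by rewrite conv_weightE.
Qed.

(** Tonelli's theorem is applied to the positive and the negative part of F(y) k(x - y), which is
    not known to be integrable on the plane. *)
Lemma measurable_conv : measurable_fun setT (conv F k).
Proof.
have ck := kernel_cont kAB.
have mf : measurable_fun setT (fun z : R * R => (F z.2 * k (z.1 - z.2))%:E).
  apply/measurable_EFinP; apply: measurable_funM; last exact: measurable_sub2.
  by apply: measurableT_comp.
rewrite /conv /Rintegral; apply: measurableT_comp => //.
under eq_fun do rewrite integralE.
apply: emeasurable_funB.
- have mfpos := measurable_funepos mf.
  apply: eq_measurable_fun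
    (@measurable_fun_fubini_tonelli_F _ _ _ _ _ mu _ mfpos (fun _ => funepos_ge0 _ _)) => x _.
  by apply: eq_integral => y _; rewrite !funeposE.
- have mfneg := measurable_funeneg mf.
  apply: eq_measurable_fun
    (@measurable_fun_fubini_tonelli_F _ _ _ _ _ mu _ mfneg (fun _ => funeneg_ge0 _ _)) => x _.
  by apply: eq_integral => y _; rewrite !funenegE.
Qed.

(** The p-th power of the pointwise bound is 2^p A^(p-1) times [conv_weight]; Tonelli's theorem then
    lets |k| be integrated in x, which supplies the last factor A. *)
Lemma conv_powR_integral :
  (\int[mu]_x (`|conv F k x| `^ p)%:E <= ((2 * A * N) `^ p)%:E)%E.
Proof.
case: kAB => ck A0 B0 kB kA kA'.
have mw : measurable_fun setT
    (fun z : R * R => (`|F z.2| `^ p * `|k (z.1 - z.2)|)%:E).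
  apply/measurable_EFinP; apply: measurable_funM.
    by apply: (measurableT_comp mFp).
  by apply: measurableT_comp => //; exact: measurable_sub2.
have w0 : forall z : R * R, (0 <= (`|F z.2| `^ p * `|k (z.1 - z.2)|)%:E)%E.
  by move=> z; rewrite lee_fin mulr_ge0// powR_ge0.
have mJ : measurable_fun setT (fun x => (conv_weight x)%:E).
  under eq_fun do rewrite -conv_weightE.
  exact: (@measurable_fun_fubini_tonelli_F _ _ _ _ _ mu _ mw w0).
apply: (@le_trans _ _ (\int[mu]_x ((2 `^ p * A `^ (p - 1))%:E * (conv_weight x)%:E))%E).
  apply: ge0_le_integral => //.
  - apply/measurable_EFinP.
    apply: (measurableT_comp (measurable_powR p)); apply: measurableT_comp => //.
    exact: measurable_conv.
  - exact: emeasurable_funM.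
  - move=> x _; rewrite -EFinM lee_fin.
    apply: (@le_trans _ _ ((2 * A `^ (1 - p^-1) * conv_weight x `^ p^-1) `^ p)).
      rewrite ge0_ler_powR ?nnegrE ?(ltW p0)// ?normr_conv_weight//.
      by rewrite !mulr_ge0// ?powR_ge0.
    rewrite !powRM ?mulr_ge0 ?powR_ge0// -!powRrM mulVf ?gt_eqF// powRr1 ?conv_weight_ge0//.
    by rewrite mulrBl mul1r mulVf ?gt_eqF.
rewrite ge0_integralZl_EFin//; last 2 first.
- by move=> x _; rewrite lee_fin conv_weight_ge0.
- by rewrite mulr_ge0 ?powR_ge0.
rewrite (_ : \int[mu]_x (conv_weight x)%:E =
    \int[mu]_y \int[mu]_x (`|F y| `^ p * `|k (x - y)|)%:E)%E; last first.
  under eq_integral do rewrite -conv_weightE.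
  exact: (@fubini_tonelli _ _ _ _ _ mu mu _ mw w0).
apply: (@le_trans _ _ ((2 `^ p * A `^ (p - 1))%:E *
    (\int[mu]_y (A%:E * (`|F y| `^ p)%:E)))%E).
  rewrite lee_wpmul2l ?lee_fin ?mulr_ge0 ?powR_ge0//.
  apply: ge0_le_integral => //.
  - by move=> y _; apply: integral_ge0 => x _; exact: (w0 (x, y)).
  - exact: (@measurable_fun_fubini_tonelli_G _ _ _ _ _ mu _ mw w0).
  - by apply: emeasurable_funM => //; exact/measurable_EFinP.
  - move=> y _; under eq_integral do rewrite EFinM.
    rewrite ge0_integralZl_EFin ?powR_ge0//.
      by rewrite muleC lee_wpmul2r ?lee_fin ?powR_ge0.
    apply/measurable_EFinP; apply: measurableT_comp => //.
    apply: measurableT_comp; first exact: continuous_measurable_fun.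
    exact: measurable_funB.
rewrite ge0_integralZl_EFin ?(ltW A0)//; last exact/measurable_EFinP.
rewrite (Lfun_integral_powR p1 FLp).2 -!EFinM lee_fin !powRM ?mulr_ge0 ?(ltW A0)//.
rewrite !mulrA ler_wpM2r ?powR_ge0// -mulrA ler_wpM2l ?powR_ge0//.
by rewrite mulrC mulr_powRB1// ltW.
Qed.

Lemma conv_vanishing :
  (forall e, 0 < e -> exists M, forall u, M <= `|u| -> `|k u| <= e) ->
  forall e, 0 < e -> exists M, forall x, M <= `|x| -> `|conv F k x| <= e.
Proof.
case: (kAB) => ck A0 B0 kB kA _ k0 e e0; apply: contrapT => nM.
(* Dominated convergence concerns sequences, so a failure at infinity is turned into points x_n with
   |x_n| >= n where the convolution exceeds e. The weights at x_n tend to 0, being dominated under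
   the integral by B |F|^p. *)
have /choice[x_ Hx] : forall n : nat, exists x, n%:R <= `|x| /\ e < `|conv F k x|.
  move=> n; apply: contrapT => nx; apply: nM; exists n%:R => x nxx.
  by rewrite leNgt; apply/negP => ex; apply: nx; exists x.
have : (conv_weight (x_ n))%:E @[n --> \oo] --> 0%E.
  rewrite [X in _ --> X](_ : _ = \int[mu]_y (cst 0 y))%E; last by rewrite integral0.
  under eq_fun do rewrite -conv_weightE.
  apply: (@dominated_cvg _ _ _ mu setT measurableT _ _
      (fun y => (B * `|F y| `^ p)%:E)) => //.
  - move=> n; apply/measurable_EFinP; apply: measurable_funM => //.
    by apply: measurableT_comp => //; exact: measurable_shift.
  - move=> y _; apply: cvg_EFin; first exact: nearW.
    apply/cvgr0Pnorm_le => d d0 /=.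
    have Fy1 : 0 < `|F y| `^ p + 1 by rewrite ltr_wpDl ?powR_ge0.
    have [M HM] := k0 (d / (`|F y| `^ p + 1)) (divr_gt0 d0 Fy1).
    near=> n; rewrite ger0_norm ?mulr_ge0 ?powR_ge0//.
    apply: (@le_trans _ _ (`|F y| `^ p * (d / (`|F y| `^ p + 1)))).
      rewrite ler_wpM2l ?powR_ge0// HM//.
      have [nx _] := Hx n.
      rewrite (le_trans _ (lerB_normD _ _))// normrN lerBrDr (le_trans _ nx)//.
      near: n; exact: nbhs_infty_ger.
    by rewrite mulrCA ler_piMr ?(ltW d0)// ler_pdivrMr// mul1r lerDl.
  - under eq_fun do rewrite EFinM.
    apply: integrableZl => //; apply/integrableP; split; first exact/measurable_EFinP.
    under eq_integral do rewrite gee0_abs ?lee_fin ?powR_ge0//.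
    by rewrite (Lfun_integral_powR p1 FLp).2 ltry.
  - move=> n y _; rewrite gee0_abs ?lee_fin ?mulr_ge0 ?powR_ge0//.
    by rewrite mulrC ler_wpM2r ?powR_ge0.
(* Chosen so that 2 A^(1-1/p) c^(1/p) = e: a weight below c contradicts the choice of x_n. *)
pose c := (e / (2 * A `^ (1 - p^-1))) `^ p.
have c0 : 0 < c by rewrite powR_gt0// divr_gt0// mulr_gt0// powR_gt0.
move=> /fine_cvgP[_ /cvgr0Pnorm_lt /(_ c c0)] [n _ /(_ n (leqnn n))] /=.
rewrite ger0_norm ?conv_weight_ge0// => wc.
have [_] := Hx n; apply/negP; rewrite -leNgt.
apply: (le_trans (normr_conv_weight _)).
have A2 : 0 < 2 * A `^ (1 - p^-1) by rewrite mulr_gt0// powR_gt0.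
rewrite -ler_pdivlMl// mulrC.
have -> : e / (2 * A `^ (1 - p^-1)) = c `^ p^-1.
  by rewrite /c -powRrM mulfV ?gt_eqF// powRr1// divr_ge0 ?ltW.
by rewrite ge0_ler_powR ?nnegrE ?invr_ge0 ?conv_weight_ge0 ?ltW.
Unshelve. all: by end_near. Qed.

End conv_Lp.

(** The increment is F integrated against k(x - .) - k(y - .), whose L^1 norm is at most 2A and
    whose sup norm is at most L |x - y|. This gives Hoelder continuity of exponent 1/p. *)
Lemma conv_continuous p F (k : R -> R) (A B L : R) : 1 <= p -> F \in Lfun mu p%:E ->
  kernel_bound k A B -> (forall x y, `|k x - k y| <= L * `|x - y|) ->
  continuous (conv F k).
Proof.
move=> p1 FLp kAB kL x; case: (kAB) => ck A0 B0 kB kA _.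
have p0 : 0 < p by exact: lt_le_trans p1.
have [mF iF] := Lfun_integral_powR p1 FLp.
set N := fine _ in iF.
have L0 : 0 <= L by rewrite -[L]mulr1 -[1](@normr1 R) -[1]subr0 (le_trans _ (kL _ _)).
have N0 : 0 <= N by rewrite fine_ge0 ?Lnorm_ge0.
pose C := 2 * N * (2 * A) `^ (1 - p^-1).
have C0 : 0 <= C by rewrite !mulr_ge0 ?powR_ge0.
have main y : `|conv F k x - conv F k y| <= C * (L * `|x - y|) `^ p^-1.
  have [ix _] := conv_sup p1 FLp kAB x; have [iy _] := conv_sup p1 FLp kAB y.
  rewrite /conv -RintegralB//.
  pose h (z : R) : R := k (x - z) - k (y - z).
  have mh : measurable_fun setT h.
    by apply: measurable_funB; exact: measurable_shift.
  under eq_Rintegral do rewrite -mulrBr -/(h _).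
  have bd : (\int[mu]_z (`|F z * h z|)%:E <= (C * (L * `|x - y|) `^ p^-1)%:E)%E.
    apply: weighted_integral_le_sup; rewrite ?mulr_ge0 ?mulr_gt0 ?iF//.
    - apply: (@le_trans _ _ (\int[mu]_z ((`|k (x - z)|)%:E + (`|k (y - z)|)%:E))%E).
        apply: ge0_le_integral => //.
        + by apply/measurable_EFinP; exact: measurableT_comp.
        + by apply: emeasurable_funD; apply/measurable_EFinP;
            apply: measurableT_comp => //; exact: measurable_shift.
        + by move=> z _; rewrite -EFinD lee_fin; exact: ler_normB.
      rewrite ge0_integralD//; try (apply/measurable_EFinP;
            apply: measurableT_comp => //; exact: measurable_shift).
      by rewrite mulr2n mulrDl mul1r EFinD leeD.
    - by move=> z; rewrite (le_trans (kL _ _))// ler_wpM2l// opprB addrA subrK.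
  have mFh : measurable_fun setT (fun z => F z * h z) by exact: measurable_funM.
  have iFh : mu.-integrable setT (fun z => (F z * h z)%:E).
    apply/integrableP; split; first exact/measurable_EFinP.
    by apply: (le_lt_trans bd); rewrite ltry.
  rewrite -lee_fin EFin_normr_Rintegral//; apply: le_trans bd.
  by apply: le_abse_integral => //; exact/measurable_EFinP.
apply/cvgrPdist_le => e e0.
have C1 : 0 < C + 1 by rewrite ltr_wpDl.
have L1 : 0 < L + 1 by rewrite ltr_wpDl.
pose d := (e / (C + 1)) `^ p / (L + 1).
have d0 : 0 < d by rewrite divr_gt0// powR_gt0// divr_gt0.
exists d => //= y xyd; apply: (le_trans (main y)).
apply: (@le_trans _ _ (C * (e / (C + 1)))).
  rewrite ler_wpM2l//.
  have -> : e / (C + 1) = ((e / (C + 1)) `^ p) `^ p^-1.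
    by rewrite -powRrM mulfV ?gt_eqF// powRr1// divr_ge0 ?ltW.
  rewrite ge0_ler_powR ?nnegrE ?invr_ge0 ?(ltW p0) ?mulr_ge0 ?powR_ge0//.
  move: xyd; rewrite /ball/= ltr_pdivlMr// => /ltW; apply: le_trans.
  by rewrite mulrC ler_wpM2l// lerDl.
by rewrite mulrCA ler_piMr ?(ltW e0)// ler_pdivrMr// mul1r lerDl.
Qed.

End weighted.

(** * The heat kernel and its derivative *)

Section heat.
Context {R : realType}.
Notation mu := (@lebesgue_measure R).

Lemma integral_shift (G : R -> R) (x : R) : continuous G -> (forall u, 0 <= G u) ->
  (\int[mu]_y (G (y - x))%:E = \int[mu]_y (G y)%:E)%E.
Proof.
move=> cG G0.
have dF (y : R) : is_derive y 1 (fun y => y - x) 1.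
  by apply: is_derive_eq; rewrite subr0.
have dF1 : derive1 (fun y => y - x) = cst 1.
  by apply/funext => y; rewrite derive1E; have [_ ->] := dF y.
rewrite [RHS](@increasing_ge0_integration_by_substitutionT _ (fun y => y - x))//.
- apply: eq_integral => y _; rewrite dF1.
  by rewrite /= mulr1.
- by move=> a b; rewrite ltrD2r.
- rewrite dF1; exact: cst_continuous.
- by rewrite dF1; exact: is_cvg_cst.
- by rewrite dF1; exact: is_cvg_cst.
- exact: cvg_addrr_Ny.
- exact: cvg_addrr.
Qed.

Section fixed_t.
Variable t : R.
Hypothesis t0 : 0 < t.

Notation Th := (@heat_kernel R t).
Notation K := (derive1 Th).
Let c : R := (2 * Num.sqrt (pi * t))^-1.

Let c0 : 0 < c.
Proof. by rewrite invr_gt0 mulr_gt0// sqrtr_gt0 mulr_gt0// pi_gt0. Qed.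

Let t4 : 0 < 4 * t. Proof. by rewrite mulr_gt0. Qed.

Lemma is_derive_heat_kernel (x : R) :
  is_derive x 1 Th (- (x / (2 * t)) * Th x).
Proof.
rewrite /heat_kernel; apply: is_derive_eq.
rewrite /GRing.scale/= mulr0 add0r; set s := Num.sqrt _.
have s0 : 0 < s by rewrite sqrtr_gt0 mulr_gt0// pi_gt0.
by field; rewrite !gt_eqF.
Qed.

Lemma derive1_heat_kernel (x : R) : K x = - (x / (2 * t)) * Th x.
Proof. by rewrite derive1E; have [_ ->] := is_derive_heat_kernel x. Qed.

Lemma heat_kernel_ge0 (x : R) : 0 <= Th x.
Proof. by rewrite mulr_ge0 ?expR_ge0 ?(ltW c0). Qed.

Lemma continuous_heat_kernel : continuous Th.
Proof.
move=> x; apply/differentiable_continuous/derivable1_diffP.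
by have [] := is_derive_heat_kernel x.
Qed.

Lemma is_derive_derive1_heat_kernel (x : R) :
  is_derive x 1 K ((x ^+ 2 / (4 * t ^+ 2) - (2 * t)^-1) * Th x).
Proof.
rewrite (_ : K = fun x => - (x / (2 * t)) * Th x); last first.
  by apply/funext => y; rewrite derive1_heat_kernel.
have := is_derive_heat_kernel x => h; apply: is_derive_eq.
rewrite /GRing.scale/= mulr0 add0r.
by field; rewrite gt_eqF.
Qed.

Lemma continuous_derive1_heat_kernel : continuous K.
Proof.
move=> x; apply/differentiable_continuous/derivable1_diffP.
by have [] := is_derive_derive1_heat_kernel x.
Qed.

(** This is 1 + z <= e^z at z = x^2 / (4t). The bounds of Theta_t, |x| Theta_t and x^2 Theta_t below
    all come from it. *)
Let heat_kernel_decay (x : R) : (1 + x ^+ 2 / (4 * t)) * Th x <= c.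
Proof.
rewrite /heat_kernel -/c mulrCA ger_pMr// mulNr expRN ler_pdivrMr ?expR_gt0// mul1r.
exact: expR_ge1Dx.
Qed.

Lemma heat_kernel_le (x : R) : Th x <= c.
Proof.
apply: le_trans (heat_kernel_decay x); rewrite ler_peMl ?heat_kernel_ge0//.
by rewrite lerDl divr_ge0 ?sqr_ge0 ?(ltW t4).
Qed.

Let abs_mul_heat_kernel_le (x : R) : `|x| * Th x <= Num.sqrt t * c.
Proof.
have st : 0 < Num.sqrt t by rewrite sqrtr_gt0.
have tE : t = Num.sqrt t ^+ 2 by rewrite sqr_sqrtr ?ltW.
apply: (@le_trans _ _ (Num.sqrt t * ((1 + x ^+ 2 / (4 * t)) * Th x))).
  move: (Th x) (heat_kernel_ge0 x) => h h0; rewrite mulrA ler_wpM2r//.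
  rewrite -subr_ge0 -[x ^+ 2]real_normK ?num_real//.
  rewrite (_ : _ - _ = Num.sqrt t * (1 - `|x| / (2 * Num.sqrt t)) ^+ 2).
    by rewrite mulr_ge0 ?sqr_ge0 ?ltW.
  by rewrite {2}tE; field; rewrite gt_eqF.
by rewrite ler_wpM2l ?(ltW st).
Qed.

Let sqr_mul_heat_kernel_le (x : R) : x ^+ 2 * Th x <= 4 * t * c.
Proof.
apply: (@le_trans _ _ (4 * t * ((1 + x ^+ 2 / (4 * t)) * Th x))).
  move: (Th x) (heat_kernel_ge0 x) => h h0; rewrite mulrA ler_wpM2r// mulrDr mulr1.
  by rewrite mulrCA mulfV ?gt_eqF// mulr1 lerDr ltW.
by rewrite ler_wpM2l ?(ltW t4).
Qed.

Lemma normr_derive1_heat_kernel (x : R) : `|K x| = (2 * t)^-1 * (`|x| * Th x).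
Proof.
rewrite derive1_heat_kernel; move: (Th x) (heat_kernel_ge0 x) => h h0.
rewrite mulNr normrN !normrM (ger0_norm h0).
by rewrite normfV (@gtr0_norm _ (2 * t)) ?mulr_gt0//; ring.
Qed.

Lemma heat_kernel_vanish (e : R) : 0 < e ->
  exists M, forall u, M <= `|u| -> `|Th u| <= e.
Proof.
move=> e0; exists (Num.sqrt t * c / e) => u hu.
have st : 0 < Num.sqrt t by rewrite sqrtr_gt0.
rewrite (ger0_norm (heat_kernel_ge0 u)).
have u0 : 0 < `|u| by apply: lt_le_trans hu; rewrite divr_gt0// mulr_gt0.
rewrite -(ler_pM2l u0) (le_trans (abs_mul_heat_kernel_le u))//.
by rewrite -ler_pdivrMr.
Qed.

Lemma derive1_heat_kernel_vanish (e : R) : 0 < e ->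
  exists M, forall u, M <= `|u| -> `|K u| <= e.
Proof.
move=> e0; exists (2 * c / e) => u hu.
have u0 : 0 < `|u| by apply: lt_le_trans hu; rewrite divr_gt0// mulr_gt0.
rewrite normr_derive1_heat_kernel -(ler_pM2l u0).
rewrite [leLHS](_ : _ = (2 * t)^-1 * (u ^+ 2 * Th u)); last first.
  by rewrite -[u ^+ 2]real_normK ?num_real//; ring.
apply: (@le_trans _ _ ((2 * t)^-1 * (4 * t * c))).
  by rewrite ler_wpM2l ?invr_ge0 ?mulr_ge0 ?(ltW t0).
rewrite (_ : _ * (4 * t * c) = 2 * c); last by field; rewrite gt_eqF.
by rewrite -ler_pdivrMr.
Qed.

(** |Theta_t'| is even and equals -Theta_t' on the positive half-line, so the integral is 2
    Theta_t(0), and [c] is Theta_t(0). *)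
Let integral_abs_derive1_heat_kernel : (\int[mu]_y (`|K y|)%:E = (2 * c)%:E)%E.
Proof.
have cK : continuous (fun y => `|K y|).
  move=> y; apply: continuous_comp; first exact: continuous_derive1_heat_kernel.
  exact: norm_continuous.
rewrite (ge0_symfun_integralT (fun=> normr_ge0 _) cK); last first.
  by move=> y; rewrite /= !normr_derive1_heat_kernel normrN /heat_kernel sqrrN.
rewrite EFinM; congr *%E.
rewrite -set_itvcy.
rewrite (@ge0_continuous_FTC2y _ (fun x => `|K x|) (fun x => - Th x) 0 0).
- rewrite -EFinB sub0r opprK /heat_kernel.
  by rewrite (_ : - 0 ^+ 2 / _ = 0) ?expR0 ?mulr1// expr0n/= oppr0 mul0r.
- by move=> x _; exact: normr_ge0.
- exact: continuous_subspaceT.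
- rewrite -oppr0; apply: cvgN; apply/cvgr0Pnorm_le => e e0.
  have [M HM] := heat_kernel_vanish e0.
  near=> x; apply: HM; apply: le_trans (ler_norm x).
  by near: x; apply: nbhs_pinfty_ge; exact: num_real.
- move=> x _; apply: derivableN; by have [] := is_derive_heat_kernel x.
- apply: cvgN; apply: cvg_at_right_filter; exact: continuous_heat_kernel.
- move=> x; rewrite in_itv/= andbT => x0.
  have dT := is_derive_heat_kernel x.
  rewrite derive1E deriveN; last by have [] := dT.
  rewrite (@derive_val _ _ _ _ _ _ _ dT) normr_derive1_heat_kernel (gtr0_norm x0).
  by field; rewrite gt_eqF.
Unshelve. all: by end_near. Qed.

Let integral_shift_even (G : R -> R) (x : R) : continuous G -> (forall u, 0 <= G u) ->
  (forall u, G (- u) = G u) ->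
  (\int[mu]_y (G (x - y))%:E = \int[mu]_y (G y)%:E)%E.
Proof.
move=> cG G0 evG; rewrite -(integral_shift x cG G0).
by apply: eq_integral => y _; rewrite -evG opprB.
Qed.

Lemma derive1_heat_kernelN (u : R) : `|K (- u)| = `|K u|.
Proof. by rewrite !normr_derive1_heat_kernel normrN /heat_kernel sqrrN. Qed.

Lemma kernel_bound_derive1_heat_kernel :
  kernel_bound K (2 * c) (c / (2 * Num.sqrt t)).
Proof.
have st : 0 < Num.sqrt t by rewrite sqrtr_gt0.
have cK : continuous (fun y => `|K y|).
  move=> y; apply: continuous_comp; first exact: continuous_derive1_heat_kernel.
  exact: norm_continuous.
split.
- exact: continuous_derive1_heat_kernel.
- by rewrite mulr_gt0.
- by rewrite divr_ge0 ?mulr_ge0 ?(ltW c0)// ltW.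
- move=> x; rewrite normr_derive1_heat_kernel.
  apply: (@le_trans _ _ ((2 * t)^-1 * (Num.sqrt t * c))).
    by rewrite ler_wpM2l ?invr_ge0 ?mulr_ge0 ?(ltW t0).
  have tE : t = Num.sqrt t ^+ 2 by rewrite sqr_sqrtr ?ltW.
  by rewrite {1}tE le_eqVlt; apply/orP; left; apply/eqP; field; rewrite gt_eqF.
- move=> x; rewrite (integral_shift_even x cK (fun=> normr_ge0 _) derive1_heat_kernelN).
  by rewrite integral_abs_derive1_heat_kernel.
- move=> y; rewrite (integral_shift y cK (fun=> normr_ge0 _)).
  by rewrite integral_abs_derive1_heat_kernel.
Qed.

Lemma derive1_heat_kernel_lipschitz : exists L, forall x y, `|K x - K y| <= L * `|x - y|.
Proof.
pose K' (x : R) := (x ^+ 2 / (4 * t ^+ 2) - (2 * t)^-1) * Th x.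
(* A bound of the second derivative: x^2 Theta_t / (4t^2) is at most c / t, and Theta_t / (2t) is at
   most c / (2t), rounded up to c / t. *)
exists (2 * c / t) => x y.
have K'b z : `|K' z| <= 2 * c / t.
  rewrite normrM (ger0_norm (heat_kernel_ge0 z)).
  apply: (@le_trans _ _ ((z ^+ 2 / (4 * t ^+ 2) + (2 * t)^-1) * Th z)).
    rewrite ler_wpM2r ?heat_kernel_ge0//.
    have h1 : 0 <= (2 * t)^-1 by rewrite invr_ge0 mulr_ge0 ?(ltW t0).
    have h2 : 0 <= z ^+ 2 / (4 * t ^+ 2).
      by rewrite divr_ge0 ?sqr_ge0// mulr_ge0 ?sqr_ge0.
    by rewrite (le_trans (ler_normB _ _))// (ger0_norm h1) (ger0_norm h2).
  rewrite mulrDl.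
  apply: (@le_trans _ _ (c / t + (2 * t)^-1 * c)).
    apply: lerD; last by rewrite ler_wpM2l ?heat_kernel_le ?invr_ge0 ?mulr_ge0 ?(ltW t0).
    rewrite (_ : _ * Th z = (z ^+ 2 * Th z) / (4 * t ^+ 2)); last by rewrite mulrAC.
    rewrite ler_pdivrMr ?mulr_gt0 ?exprn_gt0// (le_trans (sqr_mul_heat_kernel_le z))//.
    by rewrite le_eqVlt; apply/orP; left; apply/eqP; field; rewrite gt_eqF.
  rewrite (_ : 2 * c / t = c / t + c / t); last by rewrite mulr_natl mulr2n mulrDl.
  rewrite lerD2l mulrC ler_wpM2l ?(ltW c0)//.
  by rewrite lef_pV2 ?posrE ?mulr_gt0// ler_peMl ?ltW// ltr1n.
wlog xy : x y / x < y.
  move=> h; have [/eqP ->|] := boolP (x == y); first by rewrite !subrr normr0 mulr0.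
  by rewrite neq_lt => /orP[|] /h//; rewrite distrC (distrC y).
have [|z _] := @MVT R K K' x y xy (fun x _ => is_derive_derive1_heat_kernel x).
  exact/continuous_subspaceT/continuous_derive1_heat_kernel.
by rewrite distrC => ->; rewrite normrM (distrC x) ler_wpM2r.
Qed.

(** Where |x - y| <= 1, Theta_t is at most its maximum c; elsewhere it is at most |x - y| Theta_t(x
    - y) = 2t |Theta_t'(x - y)|, whose integral is known. *)
Lemma kernel_bound_heat_kernel : exists A B, kernel_bound Th A B.
Proof.
have [cK c20 cB kB kl kr] := kernel_bound_derive1_heat_kernel.
have mTh (x : R) : measurable_fun setT (fun y : R => Th (x - y)).
  exact: measurable_shift continuous_heat_kernel.
have nTh u : `|Th u| = Th u by rewrite ger0_norm ?heat_kernel_ge0.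
have Thl x : (\int[mu]_y (`|Th (x - y)|)%:E <= (2 * c + 2 * t * (2 * c))%:E)%E.
  pose I := [set` `[x - 1, x + 1]] : set R.
  have mI : measurable I by exact: measurable_itv.
  apply: (@le_trans _ _ (\int[mu]_y ((c * \1_I y)%:E + (2 * t)%:E * (`|K (x - y)|)%:E))%E).
    apply: ge0_le_integral => //.
    - by apply/measurable_EFinP; under eq_fun do rewrite nTh; exact: mTh.
    - apply: emeasurable_funD.
        apply/measurable_EFinP; apply: measurable_funM => //.
      apply: emeasurable_funM => //; apply/measurable_EFinP.
      by apply: measurableT_comp => //; apply: measurable_shift.
    - move=> y _; rewrite nTh -EFinM -EFinD lee_fin indicE.
      have [yI|yI] := boolP (y \in I).
        rewrite mulr1 (le_trans (heat_kernel_le _))// lerDl mulr_ge0//.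
        by rewrite mulr_ge0 ?(ltW t0).
      rewrite mulr0 add0r normr_derive1_heat_kernel mulrA mulfV ?mul1r; last first.
        by rewrite gt_eqF// mulr_gt0.
      rewrite ler_peMl ?heat_kernel_ge0// leNgt; apply/negP.
      rewrite ltr_norml => /andP[h1 h2]; move/negP : yI; apply; rewrite inE /I/= in_itv/=.
      by apply/andP; split; lra.
  rewrite ge0_integralD//; first last.
  - apply: emeasurable_funM => //; apply/measurable_EFinP.
    by apply: measurableT_comp => //; apply: measurable_shift.
  - by move=> y _; rewrite -EFinM lee_fin mulr_ge0// mulr_ge0 ?(ltW t0).
  - by apply/measurable_EFinP; apply: measurable_funM.
  - by move=> y _; rewrite lee_fin mulr_ge0// ltW.
  rewrite EFinD leeD//.
    under eq_integral do rewrite EFinM.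
    rewrite ge0_integralZl_EFin ?(ltW c0)//; last exact/measurable_EFinP.
    have muI : mu I = 2%:E.
      rewrite /I lebesgue_measure_itv/= lte_fin ltrD2l gtrN// -EFinB.
      by congr EFin; ring.
    by rewrite integral_indic// setIT [X in (_ * X)%E]muI -EFinM mulrC.
  rewrite ge0_integralZl_EFin ?mulr_ge0 ?(ltW t0)//; last first.
    apply/measurable_EFinP.
    by apply: measurableT_comp => //; apply: measurable_shift.
  by rewrite [leRHS]EFinM lee_wpmul2l// lee_fin mulr_ge0 ?(ltW t0).
exists (2 * c + 2 * t * (2 * c)), c; split => //.
- exact: continuous_heat_kernel.
- by rewrite addr_gt0// !mulr_gt0.
- by rewrite ltW.
- by move=> x; rewrite nTh heat_kernel_le.
- move=> y; apply: le_trans (Thl y); rewrite le_eqVlt; apply/orP; left; apply/eqP.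
  by apply: eq_integral => x _; rewrite !nTh /heat_kernel -sqrrN opprB.
Qed.

End fixed_t.
End heat.

(** * The L^r estimate *)

Section upper.
Context {R : realType}.
Notation mu := (@lebesgue_measure R).

Lemma Lp_normE (r : R) (v : R -> R) :
  (Lp_norm r%:E v = (\int[mu]_x (`|v x| `^ r)%:E) `^ r^-1)%E.
Proof. by rewrite /Lp_norm unlock. Qed.

Lemma Lp_norm_interpolation (p r : R) (v : R -> R) (S D : R) :
  0 < p -> p <= r -> 0 <= S -> 0 <= D -> measurable_fun setT v ->
  (forall x, `|v x| <= S) -> (\int[mu]_x (`|v x| `^ p)%:E <= D%:E)%E ->
  (Lp_norm r%:E v <= ((S `^ (r - p) * D) `^ r^-1)%:E)%E.
Proof.
move=> p0 pr S0 D0 mv vS vD; have r0 : 0 < r by apply: lt_le_trans pr.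
have mvX s : measurable_fun setT (fun x => `|v x| `^ s).
  by apply: (measurableT_comp (measurable_powR s)); exact: measurableT_comp.
rewrite Lp_normE -poweR_EFin.
have main : (\int[mu]_x (`|v x| `^ r)%:E <= (S `^ (r - p) * D)%:E)%E.
  apply: (@le_trans _ _ (\int[mu]_x ((S `^ (r - p))%:E * (`|v x| `^ p)%:E))%E).
    apply: ge0_le_integral => //.
    - by apply/measurable_EFinP; exact: (mvX r).
    - by apply: emeasurable_funM => //; apply/measurable_EFinP; exact: (mvX p).
    - move=> x _; rewrite -EFinM lee_fin.
      rewrite -{1}(subrK p r) (@powRD _ `|v x|); last by rewrite subrK gt_eqF.
      by rewrite ler_wpM2r ?powR_ge0// ge0_ler_powR ?nnegrE ?subr_ge0.
  rewrite ge0_integralZl_EFin//; last 2 first.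
  - apply/measurable_EFinP; exact: (mvX p).
  - exact: powR_ge0.
  by rewrite EFinM lee_wpmul2l// lee_fin powR_ge0.
apply: gt0_ler_poweR main; first by rewrite invr_ge0 ltW.
- rewrite in_itv/= leey andbT.
  by apply: integral_ge0 => x _; rewrite lee_fin powR_ge0.
- by rewrite in_itv/= leey andbT lee_fin mulr_ge0 ?powR_ge0.
Qed.

Lemma Lp_norm_sup (v : R -> R) (S : R) : (forall x, `|v x| <= S) ->
  (Lp_norm +oo%E v <= S%:E)%E.
Proof.
move=> vS; rewrite /Lp_norm unlock; case: ifPn => [_|].
  by apply/ess_supP/aeW => x /=; rewrite lee_fin.
by rewrite lee_fin (le_trans _ (vS 0)).
Qed.

(** The exponent q enters only through the real number iq = 1/q, which is 0 for q = +oo, so that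
    only r needs a case distinction. In the finite case p <= r because 1/q <= 1. *)
Variant young_exponents (p : R) (q r : \bar R) (iq : R) : Prop :=
| YoungFin (r' : R) of p <= r' & r = r'%:E & p^-1 + iq = 1 + r'^-1
| YoungInfty of r = +oo%E & p^-1 + iq = 1.

Lemma young_exponentsP (p : R) (q r : \bar R) : 1 <= p -> (1 <= q)%E -> (1 <= r)%E ->
  (p%:E^-1 + q^-1 = 1 + r^-1)%E -> young_exponents p q r (fine q^-1%E).
Proof.
move=> p1 q1 r1; rewrite inver gt_eqF ?(lt_le_trans ltr01)//.
have [iq [iq0 iq1 qE]] : exists iq : R, [/\ 0 <= iq, iq <= 1 & (q^-1)%E = iq%:E].
  case: q q1 => [q|_|//]; last by exists 0; rewrite invey.
  rewrite lee_fin => q1; have q0 : 0 < q by apply: lt_le_trans q1.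
  exists q^-1; rewrite inver gt_eqF//; split => //; first by rewrite invr_ge0 ltW.
  by rewrite invf_le1.
rewrite qE /=; case: r r1 => [r|_|//]; last first.
  by rewrite invey adde0 -EFinD => -[e]; apply: YoungInfty.
rewrite lee_fin => r1; have r0 : 0 < r by apply: lt_le_trans r1.
rewrite inver gt_eqF// -!EFinD => -[e].
apply: (@YoungFin _ _ _ _ r) => //.
have p0 : 0 < p by apply: lt_le_trans p1.
by rewrite -lef_pV2 ?posrE//; lra.
Qed.

Lemma powR_monomial (M A B a b s u e : R) : 0 <= M -> 0 <= A -> 0 <= B ->
  ((M * A `^ a * B `^ b) `^ s * (M * A) `^ u) `^ e =
  M `^ (s * e) * A `^ (a * (s * e)) * B `^ (b * (s * e)) *
  (M `^ (u * e) * A `^ (u * e)).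
Proof.
move=> M0 A0 B0; have a0 := powR_ge0 A a; have b0 := powR_ge0 B b.
have Ma0 := mulr_ge0 M0 a0.
rewrite (powRM _ Ma0 b0) (powRM _ M0 a0) (powRM _ M0 A0) !powRrM.
rewrite (powRM _ _ (mulr_ge0 (powR_ge0 M u) (powR_ge0 A u))); last first.
  by apply: mulr_ge0; [apply: mulr_ge0|]; exact: powR_ge0.
rewrite (powRM _ (powR_ge0 M u) (powR_ge0 A u)).
rewrite (powRM _ _ (powR_ge0 (B `^ b) s)); last by apply: mulr_ge0; exact: powR_ge0.
by rewrite (powRM _ (powR_ge0 M s) (powR_ge0 (A `^ a) s)).
Qed.

(** With M = 2N, M A is the L^p bound of the convolution and M A^(1-1/p) B^(1/p) its sup bound.
    Their geometric mean with weights p/r and 1 - p/r carries the exponent 1/q on A. *)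
Lemma interpolation_exponents (p r iq M A B : R) : 0 < p -> 0 < r ->
  p^-1 + iq = 1 + r^-1 -> 0 <= M -> 0 < A -> 0 <= B ->
  ((M * A `^ (1 - p^-1) * B `^ p^-1) `^ (r - p) * (M * A) `^ p) `^ r^-1 =
  M * A `^ iq * B `^ (1 - iq).
Proof.
move=> p0 r0 e M0 A0 B0; rewrite (powR_monomial _ _ _ _ _ M0 (ltW A0) B0).
have e12 : (r - p) / r + p / r = 1 by field; rewrite gt_eqF.
have iqE : iq = 1 + r^-1 - p^-1 by rewrite -e; ring.
have -> : (1 - p^-1) * ((r - p) / r) = iq - p / r.
  by rewrite iqE; field; rewrite !gt_eqF.
have -> : p^-1 * ((r - p) / r) = 1 - iq.
  by rewrite iqE; field; rewrite !gt_eqF.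
move: ((r - p) / r) (p / r) e12 => e1 e2 e12.
transitivity ((M `^ e1 * M `^ e2) * (A `^ (iq - e2) * A `^ e2) * B `^ (1 - iq)).
  by ring.
rewrite -powRD; last by rewrite e12 oner_eq0.
rewrite -powRD; last by rewrite (gt_eqF A0) implybT.
by rewrite e12 powRr1// subrK.
Qed.

(** Here A = 1 / sqrt (pi t) and B = 1 / (4 sqrt(pi) t), so that A^(1/q) B^(1-1/q) contains t to the
    power -1/(2q) - (1 - 1/q) = -(2 - 1/q)/2. *)
Lemma heat_conv_upper (p : R) (q r : \bar R) (F : R -> R) (t : R) :
  1 <= p -> (1 <= q)%E -> (1 <= r)%E -> (p%:E^-1 + q^-1 = 1 + r^-1)%E ->
  F \in Lfun mu p%:E -> 0 < t ->
  (Lp_norm r (heat_conv F t) <=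
   (2 * (Num.sqrt pi)^-1 `^ (fine q^-1%E) * (4 * Num.sqrt pi)^-1 `^ (1 - fine q^-1%E))%:E
   * Lp_norm p%:E F * (t `^ (- ((2 - fine q^-1%E) / 2)))%:E)%E.
Proof.
move=> p1 q1 r1 pqr FLp t0.
have p0 : 0 < p by apply: lt_le_trans p1.
have st0 : 0 < Num.sqrt t by rewrite sqrtr_gt0.
have sp0 : 0 < Num.sqrt pi :> R by rewrite sqrtr_gt0 pi_gt0.
have := kernel_bound_derive1_heat_kernel t0.
set A := 2 * _; set B := (X in kernel_bound _ _ X) => kAB.
have AE : A = (Num.sqrt pi)^-1 * t `^ (- 2^-1).
  rewrite /A sqrtrM ?pi_ge0// powRN powR12_sqrt ?(ltW t0)//.
  by field; rewrite !gt_eqF.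
have BE : B = (4 * Num.sqrt pi)^-1 * t `^ (- 1).
  rewrite /B sqrtrM ?pi_ge0// powR_inv1 ?(ltW t0)//.
  rewrite -[in RHS](sqr_sqrtr (ltW t0)).
  by field; rewrite !gt_eqF.
have A0 := kernel_A_gt0 kAB; have B0 := kernel_B_ge0 kAB.
set iq := fine _.
set N := fine (Lp_norm p%:E F).
have NE : Lp_norm p%:E F = N%:E by rewrite fineK ?Lfun_norm_fin.
have N0 : 0 <= N by rewrite fine_ge0 ?Lnorm_ge0.
have -> : ((2 * (Num.sqrt pi)^-1 `^ iq * (4 * Num.sqrt pi)^-1 `^ (1 - iq))%:E
   * Lp_norm p%:E F * (t `^ (- ((2 - iq) / 2)))%:E =
   ((2 * N) * A `^ iq * B `^ (1 - iq))%:E)%E.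
  rewrite NE -!EFinM AE BE !powRM ?powR_ge0 ?invr_ge0 ?mulr_ge0 ?(ltW sp0)//.
  rewrite -!powRrM.
  have -> : - ((2 - iq) / 2) = - 2^-1 * iq + - 1 * (1 - iq) by field.
  rewrite (@powRD _ t); last by rewrite (gt_eqF t0) implybT.
  by congr EFin; ring.
have vS x : `|heat_conv F t x| <= 2 * N * A `^ (1 - p^-1) * B `^ p^-1.
  by have [] := conv_sup p1 FLp kAB x.
have vD := conv_powR_integral p1 FLp kAB.
have mv := measurable_conv p1 FLp kAB.
have S0 : 0 <= 2 * N * A `^ (1 - p^-1) * B `^ p^-1 by rewrite !mulr_ge0 ?powR_ge0.
have D0 : 0 <= (2 * A * N) `^ p by rewrite powR_ge0.
have [r' pr -> e|-> e] := young_exponentsP p1 q1 r1 pqr; rewrite -/iq in e.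
  have r0 : 0 < r' by apply: lt_le_trans pr.
  apply: (le_trans (Lp_norm_interpolation p0 pr S0 D0 mv vS vD)).
  rewrite lee_fin -(mulrA 2 A) (mulrC A) mulrA.
  by rewrite (interpolation_exponents p0 r0 e)// mulr_ge0.
apply: (le_trans (Lp_norm_sup vS)); rewrite lee_fin.
have -> : iq = 1 - p^-1 by rewrite -e; ring.
by rewrite (_ : 1 - (1 - p^-1) = p^-1)//; ring.
Qed.

End upper.

(** * Sharpness *)

Section tempered_primitive.
Context {R : realType}.
Notation mu := (@lebesgue_measure R).

Lemma integral_oneDsqrV : (\int[mu]_x (`|(1 + x ^+ 2)^-1|)%:E = (pi : R)%:E)%E.
Proof.
have w0 (x : R) : 0 <= (oneDsqr x)^-1 by rewrite invr_ge0 (le_trans ler01)// oneDsqr_ge1.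
under eq_integral => x _ do rewrite (ger0_norm (w0 x)).
rewrite (@ge0_symfun_integralT _ (fun x => (oneDsqr x)^-1) w0); last 2 first.
- exact: continuous_oneDsqrV.
- by move=> x /=; rewrite /oneDsqr sqrrN.
rewrite -set_itvcy integral0y_oneDsqr -EFinM mulrC divfK//.
Qed.

(** The weight 1 / (1 + x^2) has integral pi and is at most 1, so it can be paired with G; D bounds
    that pairing. Hence the distributional derivative of G is controlled by the Schwartz seminorms
    with n = 1 and m = 0, 2. *)
Lemma Lfun_schwartz_decay (p : R) (G : R -> R) : 1 <= p -> G \in Lfun mu p%:E ->
  exists2 D : R, 0 <= D & forall (h : R -> R) (C : R), 0 <= C -> measurable_fun setT h ->
    (forall x, `|h x| * (1 + x ^+ 2) <= C) ->
    mu.-integrable setT (fun x => (G x * h x)%:E) /\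
    `|(\int[mu]_x (G x * h x))%R| <= C * D.
Proof.
move=> p1 GLp; have [mG iG] := Lfun_integral_powR p1 GLp.
set N := fine _ in iG; have N0 : 0 <= N by rewrite fine_ge0 ?Lnorm_ge0.
pose w (x : R) : R := (1 + x ^+ 2)^-1.
have w1 (x : R) : 0 < 1 + x ^+ 2 by rewrite ltr_wpDr ?sqr_ge0.
have mw : measurable_fun setT w.
  by apply: continuous_measurable_fun; exact: continuous_oneDsqrV.
have hw : (\int[mu]_x (`|G x * w x|)%:E <=
    (2 * N * pi `^ (1 - p^-1) * 1 `^ p^-1)%:E)%E.
  apply: weighted_integral_le_sup => //; first exact: pi_gt0.
  - by rewrite iG.
  - by rewrite integral_oneDsqrV.
  - move=> x; rewrite ger0_norm ?invr_ge0 ?(ltW (w1 x))// invf_le1//.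
    by rewrite lerDl sqr_ge0.
set D := _ * _ in hw.
have D0 : 0 <= D by rewrite !mulr_ge0 ?powR_ge0.
exists D => // h C C0 mh hC.
have mGh : measurable_fun setT (fun x => G x * h x) by exact: measurable_funM.
have bd : (\int[mu]_x (`|G x * h x|)%:E <= (C * D)%:E)%E.
  apply: (@le_trans _ _ (\int[mu]_x (C%:E * (`|G x * w x|)%:E))%E).
    apply: ge0_le_integral => //.
    - by apply/measurable_EFinP; exact: measurableT_comp.
    - apply: emeasurable_funM => //; apply/measurable_EFinP.
      by apply: measurableT_comp => //; exact: measurable_funM.
    - move=> x _; rewrite -EFinM lee_fin !normrM mulrCA ler_wpM2l//.
      by rewrite (@ger0_norm _ (w x)) ?invr_ge0 ?(ltW (w1 x))// ler_pdivlMr.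
  rewrite ge0_integralZl_EFin//; last first.
    apply/measurable_EFinP; apply: measurableT_comp => //; exact: measurable_funM.
  by rewrite EFinM lee_wpmul2l.
have iGh : mu.-integrable setT (fun x => (G x * h x)%:E).
  apply/integrableP; split; first exact/measurable_EFinP.
  by apply: (le_lt_trans bd); rewrite ltry.
split => //; rewrite -lee_fin EFin_normr_Rintegral//; apply: le_trans bd.
by apply: le_abse_integral => //; exact/measurable_EFinP.
Qed.

Lemma measurable_derive1_smooth (phi : R -> R) : smooth phi ->
  measurable_fun setT (derive1 phi).
Proof.
move=> sphi; apply: continuous_measurable_fun => x.
apply/differentiable_continuous/derivable1_diffP.
exact: (sphi 1%N x).
Qed.

Lemma dist_deriv_tempered (p : R) (G : R -> R) : 1 <= p -> G \in Lfun mu p%:E ->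
  tempered (dist_deriv (dist_of_fun G)).
Proof.
move=> p1 GLp; have [D D0 HD] := Lfun_schwartz_decay p1 GLp.
have decay phi : schwartz phi ->
    mu.-integrable setT (fun x => (G x * derive1 phi x)%:E).
  move=> [sphi Hphi].
  have [C0 HC0] := Hphi 0%N 1%N; have [C2 HC2] := Hphi 2%N 1%N.
  have H x : `|derive1 phi x| * (1 + x ^+ 2) <= C0 + C2.
    have := HC0 x; have := HC2 x; rewrite expr0 mul1r normrM ger0_norm ?sqr_ge0//= => h2 h0.
    by rewrite mulrDr mulr1 lerD// mulrC.
  have C02 : 0 <= C0 + C2 by apply: le_trans (H 0); rewrite mulr_ge0// addr_ge0// sqr_ge0.
  exact: (HD _ _ C02 (measurable_derive1_smooth sphi) H).1.
split => [a phi psi sphi spsi|phi_ phi sphi_ sphi cphi].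
- rewrite /dist_deriv /dist_of_fun.
  have -> : derive1 (fun x => a * phi x + psi x) =
      (fun x => a * derive1 phi x + derive1 psi x).
    apply/funext => x.
    have h1 : is_derive x 1 phi (derive1 phi x).
      by rewrite derive1E; apply: derivableP; exact: (sphi.1 0%N x).
    have h2 : is_derive x 1 psi (derive1 psi x).
      by rewrite derive1E; apply: derivableP; exact: (spsi.1 0%N x).
    move: (derive1 phi x) (derive1 psi x) h1 h2 => d1 d2 h1 h2.
    have h : is_derive x 1 (fun x => a * phi x + psi x) (a * d1 + d2).
      by apply: is_derive_eq; rewrite /GRing.scale/= ?mulr0 ?addr0.
    by rewrite derive1E; apply: derive_val.
  under eq_Rintegral do rewrite mulrDr mulrCA.
  rewrite RintegralD//; last exact: decay.
    rewrite RintegralZl//; last exact: decay.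
    by rewrite opprD mulrN.
  have := integrableZl measurableT a (decay _ sphi).
  by under eq_fun do rewrite -EFinM.
- apply/cvgrPdist_le => e e0.
  pose d := e / (2 * (D + 1)).
  have D1 : 0 < D + 1 by rewrite ltr_wpDl.
  have d0 : 0 < d by rewrite divr_gt0// mulr_gt0.
  have := cphi 0%N 1%N d d0; have := cphi 2%N 1%N d d0.
  apply: filterS2 => k H2 H0.
  rewrite /dist_deriv /dist_of_fun opprK addrC.
  rewrite -RintegralB//; [|exact: decay..].
  under eq_Rintegral do rewrite -mulrBr.
  have H x : `|derive1 (phi_ k) x - derive1 phi x| * (1 + x ^+ 2) <= 2 * d.
    have := H0 x; have := H2 x; rewrite expr0 mul1r normrM ger0_norm ?sqr_ge0//= => h2 h0.
    by rewrite mulrDr mulr1 mulr2n mulrDl mul1r lerD// mulrC.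
  have d20 : 0 <= 2 * d by rewrite mulr_ge0 ?ltW.
  have mh : measurable_fun setT (fun x => derive1 (phi_ k) x - derive1 phi x).
    by apply: measurable_funB; apply: measurable_derive1_smooth;
      [exact: (sphi_ k).1|exact: sphi.1].
  have [_ /le_trans] := HD _ _ d20 mh H; apply.
  rewrite /d (_ : 2 * (e / _) * D = e * (D / (D + 1))); last by field; rewrite gt_eqF.
  by rewrite ler_piMr ?(ltW e0)// ler_pdivrMr// mul1r lerDl.
Qed.

(** Reduces the search for g in the sharpness statement to that of a function of L^p. *)
Lemma Lprime_of_Lfun (p : R) (G : R -> R) : 1 <= p -> G \in Lfun mu p%:E ->
  Lprime p%:E (dist_deriv (dist_of_fun G)) /\
  primitive p%:E (dist_deriv (dist_of_fun G)) G.
Proof.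
move=> p1 GLp; have pG : primitive p%:E (dist_deriv (dist_of_fun G)) G by split.
by split => //; split; [exact: (dist_deriv_tempered p1)|exists G].
Qed.

End tempered_primitive.

(** * Lower bounds and the extremal primitive *)

Section sharpness.
Context {R : realType}.
Notation mu := (@lebesgue_measure R).

Lemma Lp_norm_lower (r : R) (v : R -> R) (m d : R) : 0 < r -> 0 <= m -> 0 < d ->
  measurable_fun setT v -> (forall x, 0 < x < d -> m <= `|v x|) ->
  ((m * d `^ r^-1)%:E <= Lp_norm r%:E v)%E.
Proof.
move=> r0 m0 d0 mv vm.
rewrite Lp_normE.
have mvX : measurable_fun setT (fun x => `|v x| `^ r).
  by apply: (measurableT_comp (measurable_powR r)); exact: measurableT_comp.
have main : ((m `^ r * d)%:E <= \int[mu]_x (`|v x| `^ r)%:E)%E.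
  apply: (@le_trans _ _ (\int[mu]_(x in [set` `]0%R, d[%R]) (`|v x| `^ r)%:E)%E); last first.
    by apply: ge0_subset_integral => //; exact/measurable_EFinP.
  apply: (@le_trans _ _ (\int[mu]_(x in [set` `]0%R, d[%R]) (cst (m `^ r)%:E x))%E).
    rewrite integral_cst//= lebesgue_measure_itv/= lte_fin d0 sube0 EFinM.
    exact: lexx.
  apply: ge0_le_integral => //.
  - by move=> x _ /=; rewrite lee_fin powR_ge0.
  - by apply/measurable_EFinP; apply: measurable_funTS.
  - move=> x /=; rewrite in_itv/= => xd; rewrite lee_fin.
    by rewrite ge0_ler_powR ?nnegrE ?(ltW r0)// vm.
have -> : ((m * d `^ r^-1)%:E = (m `^ r * d)%:E `^ r^-1)%E.
  rewrite poweR_EFin powRM ?powR_ge0 ?(ltW d0)// -powRrM mulfV ?gt_eqF//.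
  by rewrite powRr1.
apply: gt0_ler_poweR main; first by rewrite invr_ge0 ltW.
- by rewrite in_itv/= leey andbT lee_fin mulr_ge0 ?powR_ge0 ?ltW.
- rewrite in_itv/= leey andbT.
  by apply: integral_ge0 => x _; rewrite lee_fin powR_ge0.
Qed.

Lemma Lp_norm_lower_infty (v : R -> R) (m d : R) : 0 < d ->
  (forall x, 0 < x < d -> m <= `|v x|) -> (m%:E <= Lp_norm +oo%E v)%E.
Proof.
move=> d0 vm; rewrite /Lp_norm unlock.
have muT : (0 < mu [set: R])%E.
  apply: (@lt_le_trans _ _ (mu [set` `]0%R, d[%R])).
    by rewrite lebesgue_measure_itv/= lte_fin d0 sube0 lte_fin.
  by apply: le_measure; rewrite ?inE.
rewrite muT leNgt; apply/negP => hlt.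
(* A null set contains every point where |v| exceeds its essential supremum; if the latter were
   below m, this set would contain ]0, d[. *)
have [A [mA A0 sub]] := ess_sup_ge mu (abse \o (EFin \o v)).
suff : (mu [set` `]0%R, d[%R] <= mu A)%E.
  by rewrite A0 lebesgue_measure_itv/= lte_fin d0 sube0 lee_fin leNgt d0.
apply: le_measure; rewrite ?inE// => x; rewrite /= in_itv/= => xd.
apply: sub => /= h; have := le_lt_trans h hlt.
by rewrite lte_fin ltNge vm.
Qed.

(** For x > 0 > y the factor Theta_s'(x - y) is negative, so the absolute value of the integral is
    the integral of the absolute value, which may be restricted to the interval where G >= a. *)
Lemma heat_conv_lower (p : R) (G : R -> R) (s a : R) : 1 <= p ->
  G \in Lfun mu p%:E -> (forall y, 0 <= G y) -> (forall y, 0 <= y -> G y = 0) ->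
  0 < s -> 0 <= a ->
  {ae mu, forall y, - Num.sqrt s <= y <= - (Num.sqrt s / 2) -> a <= G y} ->
  forall x, 0 < x < Num.sqrt s ->
    a * (expR (- 1) / (16 * Num.sqrt pi)) * s `^ (- 2^-1) <= `|heat_conv G s x|.
Proof.
move=> p1 GLp G0 Gsupp s0 a0 aeG x /andP[x0 xs].
have [mG _] := Lfun_integral_powR p1 GLp.
set w := Num.sqrt s in aeG xs *.
have w0 : 0 < w by rewrite sqrtr_gt0.
have sE : s = w ^+ 2 by rewrite sqr_sqrtr ?ltW.
have spi0 : 0 < Num.sqrt pi :> R by rewrite sqrtr_gt0 pi_gt0.
set K := derive1 (heat_kernel s).
have KE u : K u = - (u / (2 * s)) * heat_kernel s u by exact: derive1_heat_kernel.
have kAB := kernel_bound_derive1_heat_kernel s0.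
have [iGK _] := conv_sup p1 GLp kAB x.
have mK : measurable_fun setT (fun y : R => K (x - y)).
  exact: measurable_shift (kernel_cont kAB).
have GKN y : G y * K (x - y) = - `|G y * K (x - y)|.
  have [y0|y0] := leP 0 y; first by rewrite Gsupp// mul0r normr0 oppr0.
  rewrite ler0_norm ?opprK// KE mulNr mulrN oppr_le0 mulr_ge0// mulr_ge0 ?heat_kernel_ge0//.
  by rewrite divr_ge0 ?mulr_ge0 ?(ltW s0)//; lra.
rewrite -lee_fin EFin_normr_Rintegral//.
have -> : (\int[mu]_y (G y * K (x - y))%:E = - \int[mu]_y (`|G y * K (x - y)|)%:E)%E.
  by rewrite -integral_ge0N//; apply: eq_integral => y _; rewrite {1}GKN.
rewrite abseN gee0_abs; last by apply: integral_ge0 => y _; rewrite lee_fin.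
pose I := [set` `[- w, - (w / 2)]] : set R.
have mI : measurable I by exact: measurable_itv.
(* Lower bound of |Theta_s'(u)| for sqrt s / 2 <= u <= 2 sqrt s: the linear factor is taken at sqrt
   s / 2, and u^2 / (4s) <= 1 in the exponential. The interval of y has length sqrt s / 2, which
   turns 8 into 16. *)
pose k := expR (- 1) / (8 * Num.sqrt pi * s).
have k0 : 0 <= k by rewrite divr_ge0 ?expR_ge0// !mulr_ge0// ltW.
have mGK : measurable_fun setT (fun y => `|G y * K (x - y)|).
  by apply: measurableT_comp => //; exact: measurable_funM.
apply: (@le_trans _ _ (\int[mu]_(y in I) (cst (a * k)%:E y))%E).
  have muI : mu I = (w / 2)%:E.
    rewrite /I lebesgue_measure_itv/= lte_fin ltrN2 ltr_pdivrMr//.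
    by rewrite ltr_pMr// ltr1n -EFinB; congr EFin; field.
  rewrite integral_cst// [X in (_ <= _ * X)%E]muI -EFinM lee_fin.
  rewrite -mulrA -[leRHS]mulrA ler_wpM2l// /k powRN powR12_sqrt ?(ltW s0)// -/w.
  rewrite sE le_eqVlt; apply/orP; left; apply/eqP.
  by field; rewrite !gt_eqF.
apply: (@le_trans _ _ (\int[mu]_(y in I) (`|G y * K (x - y)|)%:E)%E); last first.
  by apply: ge0_subset_integral => //; exact/measurable_EFinP.
apply: ae_ge0_le_integral => //.
- by move=> y _ /=; rewrite lee_fin mulr_ge0.
- by apply/measurable_EFinP; exact: measurable_funTS.
- case: aeG => Z [mZ Z0 sub]; exists Z; split => // y /= hy; apply: sub => /= aG.
  apply: hy; rewrite /I/= in_itv/= => yI.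
  rewrite lee_fin normrM (ger0_norm (G0 y)) ler_pM//; first exact: aG.
  move/andP: yI => [y1 y2].
  rewrite normr_derive1_heat_kernel//.
  have u1 : w / 2 <= x - y by lra.
  have u2 : x - y <= 2 * w by lra.
  have u0 : 0 < x - y by apply: lt_le_trans u1; rewrite divr_gt0.
  rewrite gtr0_norm//.
  apply: (@le_trans _ _ ((2 * s)^-1 * ((w / 2) * ((2 * Num.sqrt (pi * s))^-1 * expR (- 1))))).
    rewrite /k sqrtrM ?pi_ge0// -/w sE le_eqVlt; apply/orP; left; apply/eqP.
    by field; rewrite !gt_eqF.
  rewrite ler_wpM2l ?invr_ge0 ?mulr_ge0 ?(ltW s0)//.
  have c0 : 0 <= (2 * Num.sqrt (pi * s))^-1 by rewrite invr_ge0 mulr_ge0 ?sqrtr_ge0.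
  apply: ler_pM u1 _; [by rewrite divr_ge0 ?ltW|by rewrite mulr_ge0 ?expR_ge0|].
  rewrite /heat_kernel ler_wpM2l//.
  rewrite ler_expR mulNr lerN2 ler_pdivrMr ?mulr_gt0// mul1r sE.
  rewrite (_ : 4 * w ^+ 2 = (2 * w) ^+ 2); last by ring.
  by rewrite ler_sqr ?nnegrE ?mulr_ge0 ?(ltW u0) ?(ltW w0).
Qed.

(* The humps lie on the negative axis, where Theta'(x - y) has a constant sign
   for all x > 0, so that different humps do not cancel. *)
Lemma gliding_hump (p : R) (s : nat -> R) : 1 <= p -> (forall k, 0 < s k) ->
  exists G : R -> R, [/\ G \in Lfun mu p%:E, (forall y, 0 <= G y),
    (forall y, 0 <= y -> G y = 0) &
    forall k, {ae mu, forall y, - Num.sqrt (s k) <= y <= - (Num.sqrt (s k) / 2) ->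
       (2 ^- k * s k `^ (- 2^-1)) `^ p^-1 <= G y}].
Proof.
move=> p1 s0; have p0 : 0 < p by apply: lt_le_trans p1.
pose w k := Num.sqrt (s k).
have w0 k : 0 < w k by rewrite sqrtr_gt0.
pose I k := [set` `[- w k, - (w k / 2)]] : set R.
have mI k : measurable (I k) by exact: measurable_itv.
(* A hump of height 2^-k / w_k and width w_k / 2 has integral 2^-k / 2, and these integrals add up
   to 1. *)
pose h k (y : R) : \bar R := (2 ^- k / w k * \1_(I k) y)%:E.
have h0 k y : (0 <= h k y)%E.
  by rewrite lee_fin mulr_ge0// divr_ge0 ?(ltW (w0 k))// invr_ge0 exprn_ge0.
have mh k : measurable_fun setT (h k).
  by apply/measurable_EFinP; apply: measurable_funM.
pose H y := (\sum_(k <oo) h k y)%E.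
have H0 y : (0 <= H y)%E by apply: nneseries_ge0 => k _ _.
have mH : measurable_fun setT H.
  by apply: ge0_emeasurable_sum => // k y _ _.
have ih k : (\int[mu]_y h k y = (2 ^- k / 2)%:E)%E.
  rewrite /h; under eq_integral do rewrite EFinM.
  rewrite ge0_integralZl_EFin//; last 2 first.
  - by apply/measurable_EFinP; apply: measurable_indic; exact: mI.
  - by rewrite divr_ge0 ?(ltW (w0 k))// invr_ge0 exprn_ge0.
  have muI : mu (I k) = (w k / 2)%:E.
    rewrite /I lebesgue_measure_itv/= lte_fin ltrN2 ltr_pdivrMr//.
    by rewrite ltr_pMr// ltr1n -EFinB; congr EFin; field.
  have mIk : measurable (I k) by exact: mI.
  rewrite integral_indic//; first rewrite setIT [X in (_ * X)%E]muI -EFinM; congr EFin.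
  by rewrite mulrA divfK ?gt_eqF.
have iH : (\int[mu]_y H y < +oo)%E.
  rewrite integral_nneseries//.
  under eq_eseriesr do rewrite ih.
  apply: (@le_lt_trans _ _ 1%E); last exact: ltry.
  have cv : (series (geometric 2^-1 2^-1 : R^nat)) @ \oo --> (1 : R).
    have h2 : `|2^-1 : R| < 1 by rewrite ger0_norm// invf_lt1// ltr1n.
    have := @cvg_geometric_series R 2^-1 2^-1 h2.
    by rewrite (_ : 2^-1 / (1 - 2^-1) = 1)//; field.
  rewrite (_ : (fun n => _) = EFin \o series (geometric 2^-1 2^-1 : R^nat)); last first.
    apply/funext => n; rewrite /series/= sumEFin; congr EFin.
    by apply: eq_bigr => k _; rewrite /geometric/= mulrC exprVn.
  by rewrite EFin_lim; [rewrite (cvg_lim _ cv)|apply/cvg_ex; exists 1].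
have intH : mu.-integrable setT H.
  apply/integrableP; split => //.
  by under eq_integral do rewrite gee0_abs//.
(* [fine] sends +oo to 0. The series is infinite on a null set at most, and this is why the lower
   bounds of G are claimed only almost everywhere. *)
pose G y := fine (H y) `^ p^-1.
have fH0 y : 0 <= fine (H y) by rewrite fine_ge0.
have Gp y : `|G y| `^ p = fine (H y).
  by rewrite ger0_norm ?powR_ge0// -powRrM mulVf ?gt_eqF// powRr1.
have mfH : measurable_fun setT (fun y => fine (H y)) by exact: measurableT_comp.
exists G; split.
- apply: LfunP => //.
    by apply: (measurableT_comp (measurable_powR p^-1)).
  apply: le_lt_trans iH; apply: ge0_le_integral => //.
  + by apply/measurable_EFinP; under eq_fun do rewrite Gp.
  + by move=> y _; rewrite Gp; case: (H y) (H0 y) => //= ?; rewrite leey.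
- by move=> y; exact: powR_ge0.
- move=> y y0; rewrite /G /H eseries0.
    by rewrite powR0// invr_eq0 gt_eqF.
  move=> k _ _; rewrite /h indicE memNset ?mulr0// /I/= in_itv/= => /andP[_].
  by rewrite leNgt (lt_le_trans _ y0)// oppr_lt0 divr_gt0.
- move=> k; have [Z [mZ Z0 sub]] := integrable_ae measurableT intH.
  exists Z; split => // y /= hy; apply: sub => /= Hfin; apply: hy => yI.
  have {}Hfin := Hfin Logic.I.
  rewrite /G ge0_ler_powR ?nnegrE ?invr_ge0 ?(ltW p0) ?mulr_ge0 ?powR_ge0 ?invr_ge0 ?exprn_ge0//.
  rewrite -lee_fin fineK//.
  have -> : (2 ^- k * s k `^ (- 2^-1))%:E = h k y.
    rewrite /h indicE mem_set; last by rewrite /I/= in_itv.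
    by rewrite mulr1 powRN powR12_sqrt ?(ltW (s0 k)).
  apply: (@le_trans _ _ (\sum_(0 <= i < k.+1) h i y)%E); last exact: nneseries_lim_ge.
  by rewrite big_nat_recr//= leeDr// sume_ge0.
Qed.

Lemma hump_norm_lower (p : R) (q r : \bar R) (G : R -> R) (s : R) (k : nat) :
  1 <= p -> (1 <= q)%E -> (1 <= r)%E -> (p%:E^-1 + q^-1 = 1 + r^-1)%E ->
  G \in Lfun mu p%:E -> (forall y, 0 <= G y) -> (forall y, 0 <= y -> G y = 0) ->
  0 < s ->
  {ae mu, forall y, - Num.sqrt s <= y <= - (Num.sqrt s / 2) ->
     (2 ^- k * s `^ (- 2^-1)) `^ p^-1 <= G y} ->
  ((expR (- 1) / (16 * Num.sqrt pi) * 2 ^- k * s `^ (- ((2 - fine q^-1%E) / 2)))%:E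
    <= Lp_norm r (heat_conv G s))%E.
Proof.
move=> p1 q1 r1 pqr GLp G0 Gs s0 aeG.
have p0 : 0 < p by apply: lt_le_trans p1.
set c := expR (- 1) / _.
have c0 : 0 <= c by rewrite divr_ge0 ?expR_ge0 ?mulr_ge0 ?sqrtr_ge0.
have w0 : 0 < Num.sqrt s by rewrite sqrtr_gt0.
have lo := heat_conv_lower p1 GLp G0 Gs s0 (powR_ge0 _ _) aeG.
set m := (_ * _ * _) in lo; rewrite -/c in m lo.
have m0 : 0 <= m by rewrite !mulr_ge0 ?powR_ge0.
have mv := measurable_conv p1 GLp (kernel_bound_derive1_heat_kernel s0).
have := young_exponentsP p1 q1 r1 pqr; set iq := fine _ => Y.
(* [ir] stands for 1/r, with value 0 when r = +oo; it is the exponent of sqrt s, the length of the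
   interval where the lower bound holds. *)
have main ir : p^-1 + iq = 1 + ir ->
    c * 2 ^- k * s `^ (- ((2 - iq) / 2)) <= m * Num.sqrt s `^ ir.
  move=> e; rewrite /m powRM ?powR_ge0 ?invr_ge0 ?exprn_ge0//.
  rewrite -powR12_sqrt ?(ltW s0)// -!powRrM.
  have -> : - ((2 - iq) / 2) = - 2^-1 * p^-1 + - 2^-1 + 2^-1 * ir.
    have -> : iq = 1 + ir - p^-1 by rewrite -e; ring.
    by field; rewrite gt_eqF.
  rewrite (@powRD _ s); last by rewrite (gt_eqF s0) implybT.
  rewrite (@powRD _ s); last by rewrite (gt_eqF s0) implybT.
  rewrite [leRHS](_ : _ = c * (2 ^- k) `^ p^-1 *
    (s `^ (- 2^-1 * p^-1) * s `^ (- 2^-1) * s `^ (2^-1 * ir))); last by ring.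
  rewrite ler_wpM2r ?mulr_ge0 ?powR_ge0// ler_wpM2l//.
  (* As 2^-k <= 1 and 1/p <= 1, the root (2^-k)^(1/p) is at least 2^-k, which makes the constant
     independent of p. *)
  have k1 : 0 < (2 : R) ^- k <= 1.
    by rewrite invr_gt0 exprn_gt0//= invf_le1 ?exprn_gt0// exprn_ege1// ler1n.
  by apply: (ger1_powR k1); rewrite invf_le1.
case: Y => [r' pr -> e|-> e].
  apply: le_trans (Lp_norm_lower _ m0 w0 mv lo); last exact: lt_le_trans pr.
  by rewrite lee_fin main.
apply: le_trans (Lp_norm_lower_infty w0 lo).
by rewrite lee_fin (le_trans (main 0 _))// ?addr0// powRr0 mulr1.
Qed.

(** The sets B k act as a countable base of the filter; picking s_k in B k lets one argument serve
    both t -> 0+ and t -> oo. The ratio at s_k is at least a multiple of 2^-k / 4^-k = 2^k. *)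
Lemma heat_conv_rate_sharp (H : set_system R) (B : nat -> set R) (p : R)
    (q r : \bar R) (psi : R -> R) :
  ProperFilter H -> (forall k, H (B k)) -> (forall k t, B k t -> 0 < t) ->
  (forall A, H A -> exists k0, forall k, (k0 <= k)%N -> B k `<=` A) ->
  1 <= p -> (1 <= q)%E -> (1 <= r)%E -> (p%:E^-1 + q^-1 = 1 + r^-1)%E ->
  (forall t, 0 < t -> 0 < psi t) ->
  littleo_near H psi (fun t => t `^ (- ((2 - fine q^-1%E) / 2))) ->
  exists (g : (R -> R) -> R) (G : R -> R),
    [/\ Lprime p%:E g, primitive p%:E g G &
        unbounded_near H (fun t => Lp_norm r (heat_conv G t) / (psi t)%:E)%E].
Proof.
move=> FH HB Bpos Hbase p1 q1 r1 pqr psi0 lo.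
set rate := fun t => _ in lo.
have /choice[s Hs] : forall k, exists t, B k t /\ psi t <= 4 ^- k * rate t.
  move=> k; have e0 : (0 : R) < 4 ^- k by rewrite invr_gt0 exprn_gt0.
  have [t [Bt psit]] := filter_ex (filterI (HB k) (lo _ e0)).
  exists t; split => //; have t0 := Bpos _ _ Bt.
  by move: psit; rewrite !ger0_norm ?powR_ge0// ltW// psi0.
have s0 k : 0 < s k by have [/Bpos] := Hs k.
have [G [GLp G0 Gs aeG]] := gliding_hump p1 s0.
exists (dist_deriv (dist_of_fun G)), G; have [Lg pg] := Lprime_of_Lfun p1 GLp.
split => // -[M HM].
have [k0 Hk0] := Hbase _ HM.
pose c : R := expR (- 1) / (16 * Num.sqrt pi).
have c0 : 0 < c by rewrite divr_gt0 ?expR_gt0// mulr_gt0// sqrtr_gt0 pi_gt0.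
have ratio k : ((c * 2 ^+ k)%:E <= Lp_norm r (heat_conv G (s k)) / (psi (s k))%:E)%E.
  have ps := psi0 _ (s0 k).
  rewrite inver gt_eqF//.
  apply: (@le_trans _ _ ((c * 2 ^- k * rate (s k))%:E * ((psi (s k))^-1)%:E)%E).
    rewrite -EFinM lee_fin ler_pdivlMr//.
    have [_ /(ler_wpM2l (mulr_ge0 (ltW c0) (exprn_ge0 k (ler0n R 2))))] := Hs k.
    move/le_trans; apply; rewrite le_eqVlt; apply/orP; left; apply/eqP.
    have -> : (4 : R) = 2 * 2 by rewrite -natrM.
    by rewrite exprMn; field; rewrite expf_neq0.
  apply: lee_wpmul2r; first by rewrite lee_fin invr_ge0 ltW.
  exact: (hump_norm_lower p1 q1 r1 pqr GLp G0 Gs (s0 k) (aeG k)).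
(* k > |M| / c gives c 2^k >= c k > M, and k >= k0 puts s_k where the ratio is supposed to be at
   most M. *)
pose k := maxn k0 (Num.truncn (`|M| / c)).+1.
have := Hk0 k (leq_maxl _ _) _ (Hs k).1 => /(le_trans (ratio k)).
rewrite lee_fin leNgt => /negP; apply.
apply: (le_lt_trans (ler_norm M)); rewrite mulrC -ltr_pdivrMr//.
apply: (@lt_le_trans _ _ k%:R).
  by apply: (lt_le_trans (truncnS_gt _)); rewrite ler_nat leq_maxr.
by rewrite -natrX ler_nat ltnW// ltn_expl.
Qed.

Lemma heat_conv_rate_sharp_at_right0 (p : R) (q r : \bar R) (psi : R -> R) :
  1 <= p -> (1 <= q)%E -> (1 <= r)%E -> (p%:E^-1 + q^-1 = 1 + r^-1)%E ->
  (forall t, 0 < t -> 0 < psi t) ->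
  littleo_near 0^'+ psi (fun t => t `^ (- ((2 - fine q^-1%E) / 2))) ->
  exists (g : (R -> R) -> R) (G : R -> R),
    [/\ Lprime p%:E g, primitive p%:E g G &
        unbounded_near 0^'+ (fun t => Lp_norm r (heat_conv G t) / (psi t)%:E)%E].
Proof.
apply: (@heat_conv_rate_sharp _ (fun k => [set t | 0 < t < k.+1%:R^-1])).
- move=> k; near=> t; apply/andP; split; first by near: t; exact: nbhs_right_gt.
  by near: t; apply: nbhs_right_lt; rewrite invr_gt0.
- by move=> k t /andP[].
- move=> A [e /= e0 eA]; exists (Num.truncn e^-1) => k ek t /= /andP[t0 tk].
  apply: eA => //=; rewrite sub0r normrN gtr0_norm// (lt_le_trans tk)//.
  rewrite invf_ple ?posrE// (le_trans (ltW (truncnS_gt _)))//.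
  by rewrite ler_nat ltnS.
Unshelve. all: by end_near. Qed.

Lemma heat_conv_rate_sharp_pinfty (p : R) (q r : \bar R) (psi : R -> R) :
  1 <= p -> (1 <= q)%E -> (1 <= r)%E -> (p%:E^-1 + q^-1 = 1 + r^-1)%E ->
  (forall t, 0 < t -> 0 < psi t) ->
  littleo_near +oo psi (fun t => t `^ (- ((2 - fine q^-1%E) / 2))) ->
  exists (g : (R -> R) -> R) (G : R -> R),
    [/\ Lprime p%:E g, primitive p%:E g G &
        unbounded_near +oo (fun t => Lp_norm r (heat_conv G t) / (psi t)%:E)%E].
Proof.
apply: (@heat_conv_rate_sharp _ (fun k => [set t | k%:R < t])).
- by move=> k; exists k%:R; split => //; exact: num_real.
- by move=> k t /=; apply: le_lt_trans.
- move=> A [M [_ MA]]; exists (Num.truncn `|M|).+1 => k Mk t /= kt.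
  apply: MA; apply: le_lt_trans kt; rewrite (le_trans (ler_norm M))//.
  by rewrite (le_trans (ltW (truncnS_gt _)))// ler_nat.
Qed.

End sharpness.

(** * Sign, mean and limits at infinity *)

Section sign_and_mean.
Context {R : realType}.
Notation mu := (@lebesgue_measure R).

Definition vanishing (w : R -> R) :=
  forall e, 0 < e -> exists M, forall x, M <= `|x| -> `|w x| <= e.

Lemma vanishing_cvg (w : R -> R) : vanishing w ->
  w x @[x --> +oo] --> (0 : R) /\ w x @[x --> -oo] --> (0 : R).
Proof.
move=> w0; split; apply/cvgr0Pnorm_le => e e0; have [M HM] := w0 _ e0.
- exists M; split; first exact: num_real.
  by move=> x Mx; rewrite HM// (le_trans (ltW Mx))// ler_norm.
- exists (- M); split; first exact: num_real.
  move=> x Mx; rewrite HM// -normrN (le_trans _ (ler_norm _))//.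
  by rewrite lerNr ltW.
Qed.

Lemma integrable_itv_continuous (v : R -> R) (a b : R) : continuous v ->
  mu.-integrable `[a, b] (EFin \o v).
Proof.
move=> cv; apply: continuous_compact_integrable; first exact: segment_compact.
exact: continuous_subspaceT.
Qed.

Lemma ge0_vanishing_primitive_eq0 (v w : R -> R) : continuous v ->
  (forall a b, a < b -> \int[mu]_(x in `[a, b]) v x = w b - w a) ->
  vanishing w -> (forall x, 0 <= v x) -> forall x, v x = 0.
Proof.
move=> cv vw w0 v0.
have ndw a b : a < b -> w a <= w b.
  by move=> ab; rewrite -subr_ge0 -vw//; apply: Rintegral_ge0.
have wE x : w x = 0.
  apply/eqP; rewrite eq_le; apply/andP; split; apply/ler_addgt0Pr => e e0.
  - have [M HM] := w0 _ e0; pose b := `|M| + `|x| + 1.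
    have xb : x < b.
      by rewrite (le_lt_trans (ler_norm x))// /b -addrA ltr_wpDl// ltrDl.
    rewrite add0r (le_trans (ndw _ _ xb))// (le_trans (ler_norm _))// HM//.
    by rewrite ger0_norm /b ?addr_ge0// -addrA (le_trans (ler_norm M))// lerDl addr_ge0.
  - have [M HM] := w0 _ e0; pose b := - (`|M| + `|x| + 1).
    have xb : b < x.
      rewrite ltrNl (le_lt_trans (ler_norm _))// normrN -addrA.
      by rewrite ltr_wpDl// ltrDl.
    rewrite -lerBlDr sub0r (le_trans _ (ndw _ _ xb))// lerNl.
    rewrite (le_trans (ler_norm _))// normrN HM//.
    by rewrite normrN ger0_norm ?addr_ge0// -addrA (le_trans (ler_norm M))// lerDl addr_ge0.
(* By now all integrals of v over intervals vanish, whereas a positive v(x0) would give v > v(x0) /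
   2 near x0 by continuity. *)
move=> x0; apply/eqP; apply/negP => vx0.
have vp : 0 < v x0 by rewrite lt_neqAle eq_sym; apply/andP; split => //; apply/negP.
have := cv x0; move=> /cvgrPdist_lt /(_ (v x0 / 2)) []; first by rewrite divr_gt0.
move=> d /= d0 Hd.
pose a := x0 - d / 2; pose b := x0 + d / 2.
have d2 : 0 < d / 2 by rewrite divr_gt0.
have ab : a < b by rewrite /a /b; lra.
have := vw _ _ ab; rewrite !wE subr0 => I0.
suff : v x0 / 2 * (b - a) <= 0.
  by rewrite leNgt mulr_gt0 ?divr_gt0// subr_gt0.
have muI : fine (mu `[a, b]) = b - a.
  by rewrite lebesgue_measure_itv/= lte_fin ab.
rewrite -muI -Rintegral_cst// -I0; apply: le_Rintegral => //.
- exact: (integrable_itv_continuous _ _ (@cst_continuous _ _ _)).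
- exact: integrable_itv_continuous.
- move=> x; rewrite /= in_itv/= => /andP[ax xb].
  have : ball x0 d x by rewrite /ball/= ltr_norml; apply/andP; split; rewrite /a /b in ax xb; lra.
  move=> /Hd; rewrite ltr_norml => /andP[_]; lra.
Qed.

Section heat.
Variables (p : R) (F : R -> R) (t : R).
Hypotheses (p1 : 1 <= p) (FLp : F \in Lfun mu p%:E) (t0 : 0 < t).
Notation Th := (@heat_kernel R t).
Notation K := (derive1 Th).
Let mF : measurable_fun setT F. Proof. by have [] := Lfun_integral_powR p1 FLp. Qed.

Lemma heat_conv_continuous : continuous (heat_conv F t).
Proof.
have [L HL] := derive1_heat_kernel_lipschitz t0.
exact: (conv_continuous p1 FLp (kernel_bound_derive1_heat_kernel t0) HL).
Qed.

Lemma heat_conv_vanishing : vanishing (heat_conv F t).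
Proof.
apply: (conv_vanishing p1 FLp (kernel_bound_derive1_heat_kernel t0)).
by move=> e e0; exact: derive1_heat_kernel_vanish.
Qed.

Lemma conv_heat_kernel_vanishing : vanishing (conv F Th).
Proof.
have [A [B kAB]] := kernel_bound_heat_kernel t0.
apply: (conv_vanishing p1 FLp kAB).
by move=> e e0; exact: heat_kernel_vanish.
Qed.

Lemma integral_derive1_heat_kernel (a b y : R) : a < b ->
  (\int[mu]_(x in `[a, b]) (K (x - y))%:E = (Th (b - y) - Th (a - y))%:E)%E.
Proof.
move=> ab.
have dTh (x : R) : is_derive x 1 (fun x => Th (x - y)) (K (x - y)).
  have h : is_derive (x - y) 1 Th (K (x - y)).
    by rewrite derive1_heat_kernel//; exact: is_derive_heat_kernel.
  have h2 : is_derive x 1 (fun x => x - y) 1.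
    by apply: is_derive_eq; rewrite subr0.
  by rewrite -[K _]mulr1; exact: is_derive1_comp.
have cTh : continuous (fun x => Th (x - y)).
  move=> x; apply/differentiable_continuous/derivable1_diffP.
  by have [] := dTh x.
have cK : continuous (fun x => K (x - y)).
  move=> x; apply: (@continuous_comp _ _ _ (fun x => x - y) K).
    by apply: cvgB; [exact: cvg_id|exact: cvg_cst].
  exact: continuous_derive1_heat_kernel.
rewrite (@continuous_FTC2 _ _ (fun x => Th (x - y)) a b)//.
- exact: continuous_subspaceT.
- split.
  + by move=> x _; have [] := dTh x.
  + by apply: cvg_at_right_filter; exact: cTh.
  + by apply: cvg_at_left_filter; exact: cTh.
- by move=> x _; rewrite derive1E; have := dTh x => h; exact: derive_val.
Qed.

(** Fubini's theorem on the strip over [a, b]: the integral of |F(y) Theta_t'(x - y)| in y is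
    bounded uniformly in x, and [a, b] has finite length. The inner integral in x is then F(y)
    (Theta_t(b - y) - Theta_t(a - y)). *)
Lemma integral_heat_conv (a b : R) : a < b ->
  \int[mu]_(x in `[a, b]) heat_conv F t x = conv F Th b - conv F Th a.
Proof.
move=> ab.
have kAB := kernel_bound_derive1_heat_kernel t0.
have [A' [B' kAB']] := kernel_bound_heat_kernel t0.
have [C0 HC] : exists C, forall x, (\int[mu]_y (`|F y * K (x - y)|)%:E <= C%:E)%E.
  eexists => x; apply: (weighted_integral_le_sup p1 (kernel_A_gt0 kAB)
     (kernel_B_ge0 kAB) (N := fine (Lp_norm p%:E F))) => //.
  - by rewrite fine_ge0 ?Lnorm_ge0.
  - exact: measurable_shift (kernel_cont kAB).
  - by rewrite (Lfun_integral_powR p1 FLp).2.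
  - exact: (kernel_intl kAB).
  - by move=> y; exact: (kernel_le kAB).
pose I := [set` `[a, b]] : set R.
have mI : measurable I by exact: measurable_itv.
pose f (z : R * R) := (\1_I z.1 * (F z.2 * K (z.1 - z.2)))%:E.
have mf : measurable_fun setT f.
  apply/measurable_EFinP; apply: measurable_funM.
    by apply: measurableT_comp => //; exact: measurable_indic.
  apply: measurable_funM; last exact: measurable_sub2 (kernel_cont kAB).
  by apply: measurableT_comp.
have intf : (mu \x mu)%E.-integrable setT f.
  apply/(integrable12ltyP mu mu mf).
  apply: (@le_lt_trans _ _ (\int[mu]_x (C0%:E * (\1_I x)%:E))%E).
    have C00 : 0 <= C0.
      by rewrite -lee_fin (le_trans _ (HC 0))// integral_ge0.
    apply: ge0_le_integral => //.
    - by move=> x _; apply: integral_ge0.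
    - have mfa : measurable_fun setT (fun z => `|f z|)%E by exact: measurableT_comp.
      exact: (@measurable_fun_fubini_tonelli_F _ _ _ _ _ mu _ mfa (fun _ => abse_ge0 _)).
    - by apply: emeasurable_funM => //; apply/measurable_EFinP; exact: measurable_indic.
    - move=> x _; rewrite /f/=.
      under eq_integral do rewrite normrM EFinM (@ger0_norm _ (\1_I x))//.
      rewrite ge0_integralZl_EFin//; last first.
        apply/measurable_EFinP; apply: measurableT_comp => //.
        apply: measurable_funM => //; exact: measurable_shift (kernel_cont kAB).
      by rewrite muleC lee_wpmul2r// lee_fin.
  rewrite ge0_integralZl_EFin//; last 2 first.
  - by apply/measurable_EFinP; exact: measurable_indic.
  - by rewrite -lee_fin (le_trans _ (HC 0))// integral_ge0.
  rewrite integral_indic// setIT.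
  have muI : mu I = (b - a)%:E by rewrite /I lebesgue_measure_itv/= lte_fin ab.
  by rewrite [X in (_ * X)%E]muI -EFinM ltry.
have iFK x := (conv_sup p1 FLp kAB x).1.
have iFT x := (conv_sup p1 FLp kAB' x).1.
have E1 : (\int[mu]_x \int[mu]_y f (x, y) = \int[mu]_(x in I) (heat_conv F t x)%:E)%E.
  rewrite [RHS]integral_mkcond; apply: eq_integral => x _.
  transitivity ((\1_I x)%:E * \int[mu]_y (F y * K (x - y))%:E)%E.
    rewrite -(integralZl measurableT (iFK x) (\1_I x)).
    by apply: eq_integral => y _; rewrite /f/= EFinM.
  rewrite patchE indicE; case: ifPn => _; last by rewrite mul0e.
  by rewrite mul1e fineK//; exact: (integrable_fin_num measurableT (iFK x)).
have E2 : (\int[mu]_y \int[mu]_x f (x, y) =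
    \int[mu]_y (F y * Th (b - y) - F y * Th (a - y))%:E)%E.
  apply: eq_integral => y _.
  transitivity (\int[mu]_(x in I) (F y * K (x - y))%:E)%E.
    rewrite [RHS]integral_mkcond; apply: eq_integral => x _.
    by rewrite /f/= patchE indicE; case: ifPn => _; rewrite ?mul1r ?mul0r.
  under eq_integral do rewrite EFinM.
  rewrite integralZl//; last first.
    apply: integrable_itv_continuous => x; apply: (@continuous_comp _ _ _ (fun x => x - y) K).
      by apply: cvgB; [exact: cvg_id|exact: cvg_cst].
    exact: continuous_derive1_heat_kernel.
  by rewrite integral_derive1_heat_kernel// -EFinM mulrBr.
have E := etrans (esym E1) (etrans (Fubini intf) E2).
rewrite /conv -RintegralB; [|exact: measurableT|exact: iFT|exact: iFT].
exact: (congr1 fine E).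
Qed.

Lemma heat_conv_not_one_sign : ~ of_one_sign (heat_conv F t).
Proof.
move=> [[x vx] sgn].
have vE := @integral_heat_conv; have w0 := conv_heat_kernel_vanishing.
have cv := heat_conv_continuous.
suff vx0 : heat_conv F t x = 0 by rewrite vx0 eqxx in vx.
case: sgn => sgn.
  exact: (ge0_vanishing_primitive_eq0 cv vE w0 sgn).
apply: oppr_inj; rewrite oppr0.
apply: (@ge0_vanishing_primitive_eq0 (fun x => - heat_conv F t x)
  (fun x => - conv F Th x)).
- by move=> y; apply: cvgN; exact: cv.
- move=> a b ab; under eq_Rintegral do rewrite -mulN1r.
  rewrite RintegralZl//; last exact: integrable_itv_continuous.
  by rewrite vE// mulN1r opprB opprK addrC.
- by move=> e e0; have [M HM] := w0 e e0; exists M => y /HM; rewrite normrN.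
- by move=> y; rewrite oppr_ge0.
Qed.

(** For p > 1 the function v_t need not be integrable, so the integral over the line is an improper
    one, with endpoints moving independently. *)
Lemma heat_conv_mean_zero :
  (fun ab : R * R => (\int[mu]_(x in `[ab.1, ab.2]) heat_conv F t x)%R)
    @ filter_prod -oo +oo --> (0 : R).
Proof.
apply/cvgr0Pnorm_le => e e0.
have e2 : 0 < e / 2 by rewrite divr_gt0.
have [M HM] := conv_heat_kernel_vanishing e2.
exists ([set a | a < - `|M|], [set b | `|M| < b]) => /=.
  split; [exists (- `|M|)|exists `|M|]; split => //; exact: num_real.
move=> [a b] /= [aM Mb].
have ab : a < b by rewrite (lt_trans aM)// (le_lt_trans _ Mb)// ge0_cp.
rewrite integral_heat_conv// (le_trans (ler_normB _ _))// (splitr e).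
apply: lerD; apply: HM.
  by rewrite (le_trans (ler_norm M))// (le_trans (ltW Mb))// ler_norm.
rewrite (le_trans (ler_norm M))// -[leRHS]normrN (le_trans _ (ler_norm (- a)))//.
by rewrite lerNr ltW.
Qed.

Lemma heat_conv_integral_eq0 : mu.-integrable setT (EFin \o heat_conv F t) ->
  (\int[mu]_x (heat_conv F t x)%:E = 0)%E.
Proof.
move=> iv; set v := heat_conv F t.
(* Symmetric intervals are enough, since the integral is assumed to exist; n + 1 keeps them
   nondegenerate for [integral_heat_conv]. *)
pose I (n : nat) := [set` `[- n.+1%:R, n.+1%:R]] : set R.
have mI n : measurable (I n) by exact: measurable_itv.
have mv : measurable_fun setT v by apply: continuous_measurable_fun; exact: heat_conv_continuous.
have h1 : (\int[mu]_x (v x * \1_(I n) x)%:E @[n --> \oo] --> \int[mu]_x (v x)%:E)%E.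
  apply: (@dominated_cvg _ _ _ mu setT measurableT _ _ (fun x => (`|v x|)%:E)) => //.
  - move=> n; apply/measurable_EFinP; apply: measurable_funM => //.
    by apply: measurable_indic; exact: mI.
  - move=> x _; apply: cvg_near_cst; near=> n.
    rewrite indicE mem_set ?mulr1// /I/= in_itv/= -ler_norml.
    apply: (le_trans (ltW (truncnS_gt _))); rewrite ler_nat ltnS.
    by near: n; exact: nbhs_infty_ge.
  - exact: integrable_abse iv.
  - move=> n x _; rewrite lee_fin normrM indicE.
    by case: (_ \in _); rewrite ?normr1 ?normr0 ?mulr1 ?mulr0.
have h2 : (\int[mu]_x (v x * \1_(I n) x)%:E @[n --> \oo] --> 0)%E.
  have E n : (\int[mu]_x (v x * \1_(I n) x)%:E =
      (conv F Th n.+1%:R - conv F Th (- n.+1%:R))%:E)%E.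
    have np : - n.+1%:R < n.+1%:R :> R by rewrite gtrN.
    rewrite -integral_heat_conv// /Rintegral fineK; last first.
      apply: integrable_fin_num => //.
      exact: integrable_itv_continuous heat_conv_continuous.
    rewrite [RHS]integral_mkcond; apply: eq_integral => x _.
    by rewrite patchE indicE /I; case: ifPn => _; rewrite ?mulr1 ?mulr0.
  under eq_fun do rewrite E.
  apply: cvg_EFin; first exact: nearW.
  apply/cvgr0Pnorm_le => e e0.
  have e2 : 0 < e / 2 by rewrite divr_gt0.
  have [M HM] := conv_heat_kernel_vanishing e2.
  near=> n => /=.
  have Mn : M <= n.+1%:R.
    rewrite (le_trans (ler_norm M))// (le_trans (ltW (truncnS_gt _)))// ler_nat ltnS.
    by near: n; exact: nbhs_infty_ge.
  rewrite (le_trans (ler_normB _ _))// (splitr e) lerD// HM// ?normrN (le_trans Mn)// ler_norm//.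
by apply: (cvg_unique _ h1 h2).
Unshelve. all: by end_near. Qed.

Lemma heat_conv_integrable : p = 1 -> mu.-integrable setT (EFin \o heat_conv F t).
Proof.
move=> pE; have kAB := kernel_bound_derive1_heat_kernel t0.
apply/integrableP; split.
  apply/measurable_EFinP; apply: continuous_measurable_fun.
  exact: heat_conv_continuous.
have := conv_powR_integral p1 FLp kAB; rewrite pE => h.
apply: le_lt_trans (ltry _); apply: le_trans h.
rewrite le_eqVlt; apply/orP; left; apply/eqP; apply: eq_integral => x _.
by rewrite /= powRr1.
Qed.

End heat.
End sign_and_mean.

(** * The primitive vanishes off the support *)

Section bump.
Context {R : realType}.
Notation mu := (@lebesgue_measure R).

(** Meant for the endpoints of the bump, where the two sides are given by different formulas: a
    function that is O((y - x)^2) has derivative 0 at x. *)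
Lemma is_derive_quadratic (f : R -> R) (x C : R) : f x = 0 ->
  (forall y, `|f y| <= C * (y - x) ^+ 2) -> is_derive x 1 f 0.
Proof.
move=> fx fC.
have C0 : 0 <= C.
  have := fC (x + 1); rewrite addrAC subrr add0r expr1n mulr1; exact: le_trans.
have main : h^-1 *: (f (h *: 1 + x) - f x) @[h --> 0^'] --> (0 : R).
  apply/cvgr0Pnorm_le => e e0; near=> h.
  have h0 : h != 0 by near: h; exact: nbhs_dnbhs_neq.
  rewrite fx subr0 /GRing.scale/= mulr1 normrM normfV.
  rewrite mulrC ler_pdivrMr ?normr_gt0// (le_trans (fC _))//.
  rewrite addrK -[h ^+ 2]real_normK ?num_real// expr2 mulrA ler_wpM2r//.
  have : `|h| <= e / (C + 1).
    near: h; apply: nbhs_dnbhs; apply/nbhs_normP; exists (e / (C + 1)) => /=.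
      by rewrite divr_gt0// ltr_wpDl.
    by move=> h /=; rewrite sub0r normrN => /ltW.
  rewrite ler_pdivlMr ?ltr_wpDl// => /(le_trans _); apply.
  by rewrite mulrC ler_wpM2l// lerDl.
apply: DeriveDef; first by apply/cvg_ex; exists 0.
exact/cvg_lim.
Unshelve. all: by end_near. Qed.

(* The family P(x) u^k e^-u, with u = 1 / (1 - x^2), is closed under derivation,
   which yields smoothness at the endpoints without Faa di Bruno formulas. *)
Definition bumpf (P : {poly R}) (k : nat) (x : R) : R :=
  if `|x| < 1 then P.[x] * (1 - x ^+ 2)^-1 ^+ k * expR (- (1 - x ^+ 2)^-1) else 0.

Lemma bumpf_out P k x : 1 <= `|x| -> bumpf P k x = 0.
Proof. by rewrite /bumpf ltNge => ->. Qed.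

(** As u' = 2 x u^2, the derivative of P u^k e^-u is u^(k+2) e^-u times this polynomial; the powers
    of 1 - x^2 bring all terms to the common power of u. *)
Definition bumpd (P : {poly R}) (k : nat) : {poly R} :=
  P^`() * (1 - 'X ^+ 2) ^+ 2 + 'X * P * (1 - 'X ^+ 2) *+ (2 * k) - 'X * P *+ 2.

Lemma bumpd_horner P k (x : R) : (bumpd P k).[x] =
  P^`().[x] * (1 - x ^+ 2) ^+ 2 + x * P.[x] * (1 - x ^+ 2) * (2 * k%:R) -
  x * P.[x] * 2.
Proof.
rewrite /bumpd hornerD hornerN !hornerMn hornerD hornerMn !hornerM.
have -> : (1 - 'X ^+ 2 : {poly R}).[x] = 1 - x ^+ 2.
  by rewrite hornerD hornerN hornerC hornerXn.
by rewrite hornerX -[_ *+ (2 * k)]mulr_natr natrM -[_ *+ 2]mulr_natr; ring.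
Qed.

Lemma oneBsqr_gt0 (x : R) : `|x| < 1 -> 0 < 1 - x ^+ 2.
Proof.
by move=> x1; rewrite subr_gt0 -[x ^+ 2]real_normK ?num_real// expr_lt1.
Qed.

Lemma is_derive_bumpf_in (P : {poly R}) k (x : R) : `|x| < 1 ->
  is_derive x 1 (bumpf P k) (bumpf (bumpd P k) k.+2 x).
Proof.
move=> x1; have w0 := oneBsqr_gt0 x1.
have wn0 : 1 - x ^+ 2 != 0 by rewrite gt_eqF.
apply: (@near_eq_is_derive _ _ _
  (fun y => P.[y] * ((1 - y ^+ 2)^-1 ^+ k * expR (- (1 - y ^+ 2)^-1)))).
  have : \forall y \near x, `|y| < 1.
    by apply: (@cvgr_lt _ _ (nbhs x) _ Num.norm `|x|) => //; exact: norm_continuous.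
  by apply: filterS => y y1; rewrite /bumpf y1 mulrA.
have dw : is_derive x 1 (fun y : R => 1 - y ^+ 2) (- (2 * x)).
  by apply: is_derive_eq; rewrite /GRing.scale/=; ring.
have du : is_derive x 1 (fun y : R => (1 - y ^+ 2)^-1) (2 * x * (1 - x ^+ 2)^-1 ^+ 2).
  by apply: is_derive_eq; rewrite /GRing.scale/=; field.
have de : is_derive x 1 (fun y : R => expR (- (1 - y ^+ 2)^-1))
    (- (2 * x * (1 - x ^+ 2)^-1 ^+ 2) * expR (- (1 - x ^+ 2)^-1)).
  by apply: is_derive_eq; rewrite /GRing.scale/= mulrC.
have dk : is_derive x 1 (fun y : R => (1 - y ^+ 2)^-1 ^+ k)
    ((2 * k%:R) * x * (1 - x ^+ 2) * (1 - x ^+ 2)^-1 ^+ k.+2).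
  elim: k => [|k IHk].
    rewrite mulr0 !mul0r.
    by rewrite (_ : (fun _ => _) = cst 1)//; exact: is_derive_cst.
  rewrite (_ : (fun _ => _) = (fun y : R => (1 - y ^+ 2)^-1 * (1 - y ^+ 2)^-1 ^+ k)).
    apply: is_derive_eq; rewrite /GRing.scale/= !exprS -(natr1 k).
    by field.
  by apply/funext => y; rewrite exprS.
rewrite /bumpf x1 bumpd_horner.
apply: is_derive_eq.
rewrite /GRing.scale/= !(exprS _ k.+1) (exprS _ k).
move: ((1 - x ^+ 2)^-1 ^+ k) (expR _) P.[x] P^`().[x] => a b c d.
by field.
Qed.

(** The exponential series gives u^k e^-u <= (k+2)! u^-2 = (k+2)! (1 - y^2)^2, and 1 - y^2 <= 2 (1 -
    |y|) <= 2 |y - x| when |x| = 1 and |y| < 1. *)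
Lemma bumpf_quadratic P k : exists C, forall x y, `|x| = 1 ->
  `|bumpf P k y| <= C * (y - x) ^+ 2.
Proof.
have [M HM] : exists M, forall y, `|y| <= 1 -> `|P.[y]| <= M.
  have N11 : - 1 <= 1 :> R by rewrite ge0_cp.
  have cP : {within `[-1 : R, 1], continuous (fun y => `|P.[y]|)}.
    apply: continuous_subspaceT => y; apply: continuous_comp.
      exact: continuous_horner.
    exact: norm_continuous.
  have [c _ Hc] := EVT_max N11 cP.
  by exists `|P.[c]| => y y1; apply: Hc; rewrite in_itv/= -ler_norml.
have M0 : 0 <= M by rewrite (le_trans _ (HM 0 _)) ?normr0.
exists (4 * M * k.+2`!%:R) => x y x1.
have C0 : 0 <= 4 * M * k.+2`!%:R by rewrite !mulr_ge0.
have [y1|y1] := ltP `|y| 1; last by rewrite bumpf_out// normr0 mulr_ge0// sqr_ge0.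
have w0 := oneBsqr_gt0 y1; rewrite /bumpf y1.
set w := 1 - y ^+ 2 in w0 *.
have u0 : 0 < w^-1 by rewrite invr_gt0.
have eu : w^-1 ^+ k * expR (- w^-1) <= k.+2`!%:R * w ^+ 2.
  have := expR_ge1Dxn k.+1 (ltW u0); rewrite expRN ler_pdivrMr ?expR_gt0// => h.
  apply: (@le_trans _ _ (k.+2`!%:R * w ^+ 2 * (w^-1 ^+ k.+2 / k.+2`!%:R))).
    rewrite le_eqVlt; apply/orP; left; apply/eqP.
    rewrite !exprSr; field.
    by rewrite pnatr_eq0 -lt0n fact_gt0 gt_eqF.
  have c0 : 0 <= k.+2`!%:R * w ^+ 2 by rewrite mulr_ge0 ?sqr_ge0.
  by apply: (ler_wpM2l c0); apply: le_trans h; rewrite lerDr.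
rewrite -mulrA normrM (ger0_norm (mulr_ge0 (exprn_ge0 k (ltW u0)) (expR_ge0 _))).
apply: (@le_trans _ _ (M * (k.+2`!%:R * w ^+ 2))).
  by rewrite ler_pM// ?mulr_ge0 ?exprn_ge0 ?expR_ge0 ?HM// ltW.
rewrite [leRHS](_ : _ = M * (k.+2`!%:R * (4 * (y - x) ^+ 2))); last by ring.
rewrite !ler_wpM2l//.
have -> : 4 * (y - x) ^+ 2 = (2 * `|y - x|) ^+ 2.
  by rewrite exprMn real_normK ?num_real// -natrX.
rewrite ler_sqr ?nnegrE ?mulr_ge0 ?(ltW w0)//.
apply: (@le_trans _ _ (2 * (1 - `|y|))).
  rewrite /w -[y ^+ 2]real_normK ?num_real//.
  rewrite (_ : 1 - _ = (1 + `|y|) * (1 - `|y|)); last by ring.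
  by rewrite ler_wpM2r ?subr_ge0 ?(ltW y1)//; have := ltW y1; lra.
rewrite ler_wpM2l// -x1 distrC; exact: lerB_dist.
Qed.

Lemma is_derive_bumpf (P : {poly R}) k (x : R) :
  is_derive x 1 (bumpf P k) (bumpf (bumpd P k) k.+2 x).
Proof.
have [x1|x1|x1] := ltgtP `|x| 1; first exact: is_derive_bumpf_in.
  rewrite bumpf_out ?(ltW x1)//.
  apply: (@near_eq_is_derive _ _ _ (cst 0)).
  have : \forall y \near x, 1 < `|y|.
    by apply: (@cvgr_gt _ _ (nbhs x) _ Num.norm `|x|) => //; exact: norm_continuous.
  by apply: filterS => y y1; rewrite bumpf_out// ltW.
rewrite bumpf_out ?x1//.
have [C HC] := bumpf_quadratic P k.
apply: (@is_derive_quadratic _ _ C); first by rewrite bumpf_out ?x1.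
by move=> y; exact: HC.
Qed.

Lemma smooth_bumpf P k : smooth (bumpf P k).
Proof.
move=> n; suff [Q [l ->]] : exists Q l, derive1n n (bumpf P k) = bumpf Q l.
  by move=> x; have [] := is_derive_bumpf Q l x.
elim: n => [|n [Q [l E]]]; first by exists P, k.
exists (bumpd Q l), l.+2; rewrite derive1nS E; apply/funext => x.
by rewrite derive1E; have h := is_derive_bumpf Q l x; exact: derive_val.
Qed.

(** The function e^(-1/(1 - x^2)) on ]-1, 1[, left unnormalised: its translates have equal
    integrals, and only a lower bound for them is used. *)
Definition smooth_bump : R -> R := bumpf 1 0.

Lemma smooth_bumpE x : smooth_bump x = if `|x| < 1 then expR (- (1 - x ^+ 2)^-1) else 0.
Proof. by rewrite /smooth_bump /bumpf hornerC expr0 !mul1r. Qed.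

Lemma smooth_bump_ge0 x : 0 <= smooth_bump x.
Proof. by rewrite smooth_bumpE; case: ifP => // _; exact: expR_ge0. Qed.

Lemma smooth_bump_le1 x : smooth_bump x <= 1.
Proof.
rewrite smooth_bumpE; case: ifPn => // x1.
by rewrite -[leRHS]expR0 ler_expR oppr_le0 invr_ge0; exact: ltW (oneBsqr_gt0 x1).
Qed.

Lemma smooth_bump_ge x : `|x| <= 2^-1 -> expR (- 2) <= smooth_bump x.
Proof.
move=> x2; rewrite smooth_bumpE (le_lt_trans x2) ?invf_lt1 ?ltr1n// ler_expR lerN2.
have h : x ^+ 2 <= 2^-1.
  rewrite -[x ^+ 2]real_normK ?num_real// expr2 (le_trans (ler_pM _ _ x2 x2))//.
  by rewrite -invfM -natrM lef_pV2 ?posrE// ler_nat.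
by rewrite -[leRHS]invrK lef_pV2 ?posrE ?invr_gt0//; lra.
Qed.

Lemma continuous_smooth_bump : continuous smooth_bump.
Proof.
move=> x; apply/differentiable_continuous/derivable1_diffP.
by have [] := is_derive_bumpf 1 0 x.
Qed.

Lemma integrable_smooth_bump : mu.-integrable setT (EFin \o smooth_bump).
Proof.
have := @integrable_indic_itv R (- 1) 1 true false.
apply: le_integrable => //.
  by apply/measurable_EFinP; exact: continuous_measurable_fun continuous_smooth_bump.
move=> x _ /=; rewrite lee_fin indicE ger0_norm ?smooth_bump_ge0//.
case: (boolP (_ \in _)) => [_|xI]; first by rewrite normr1 smooth_bump_le1.
rewrite normr0 /smooth_bump bumpf_out// leNgt; apply/negP => x1.
move/negP: xI; apply; rewrite inE/= in_itv/= -ler_norml ltW//.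
Qed.

Definition bump_primitive (x : R) : R := \int[mu]_(t in `]-oo, x]) smooth_bump t.

Lemma is_derive_bump_primitive (x : R) : is_derive x 1 bump_primitive (smooth_bump x).
Proof.
have xu : x < x + 1 by rewrite ltrDl.
have iu : mu.-integrable [set` Interval -oo%O (BRight (x + 1))] (EFin \o smooth_bump).
  by apply: integrableS integrable_smooth_bump.
have ax : (-oo%O < BRight x)%E by rewrite ltNyr.
have [] := continuous_FTC1 xu iu ax (@continuous_smooth_bump x).
by rewrite derive1E => d e; apply: DeriveDef.
Qed.

Lemma bump_primitive_left x : x <= - 1 -> bump_primitive x = 0.
Proof.
move=> x1; rewrite /bump_primitive (@eq_Rintegral _ _ _ _ _ (cst 0)).
  by rewrite Rintegral_cst//= mul0r.
move=> t; rewrite inE/= in_itv/= => tx.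
by rewrite /smooth_bump bumpf_out// -normrN (le_trans _ (ler_norm _))// lerNr (le_trans tx).
Qed.

Lemma bump_primitive_right x : 1 <= x -> bump_primitive x = \int[mu]_t smooth_bump t.
Proof.
move=> x1; rewrite /bump_primitive Rintegral_mkcond; apply: eq_Rintegral => t _.
rewrite patchE; case: ifPn => //; rewrite notin_setE/= in_itv/= => /negP.
rewrite -ltNge => xt; rewrite /smooth_bump bumpf_out//.
by rewrite (le_trans _ (ler_norm _))// (le_trans x1)// ltW.
Qed.

Lemma smooth_bump_primitive : smooth bump_primitive.
Proof.
have E : derive1 bump_primitive = smooth_bump.
  apply/funext => x; rewrite derive1E.
  by have h := is_derive_bump_primitive x; exact: derive_val.
move=> [|n] x; first by have [] := is_derive_bump_primitive x.
have -> : derive1n n.+1 bump_primitive = derive1n n smooth_bump by rewrite /derive1n iterSr E.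
exact: smooth_bumpf.
Qed.

End bump.

(** * Test functions and mollifiers *)

Section test_functions.
Context {R : realType}.
Notation mu := (@lebesgue_measure R).

Lemma smooth_is_derive (f : R -> R) n (x : R) : smooth f ->
  is_derive x 1 (derive1n n f) (derive1n n.+1 f x).
Proof.
by move=> sf; rewrite derive1nS derive1E; apply: derivableP; exact: sf.
Qed.

Lemma smooth_affine (f : R -> R) (c d : R) : smooth f ->
  smooth (fun x => f (c * x + d)).
Proof.
move=> sf.
have dn n (x : R) : is_derive x 1 (fun x => c ^+ n * derive1n n f (c * x + d))
    (c ^+ n.+1 * derive1n n.+1 f (c * x + d)).
  have h := @smooth_is_derive f n (c * x + d) sf.
  have hc : is_derive x 1 (fun x : R => c * x + d) c.
    by apply: is_derive_eq; rewrite /GRing.scale/= ?mulr0 ?add0r ?addr0 mulr1.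
  have hh := @is_derive1_comp _ _ (fun x => c * x + d) x _ _ h hc.
  move: (derive1n n f) (derive1n n.+1 f (c * x + d)) hh => g gd hh.
  have hh' : is_derive x 1 (fun x => g (c * x + d)) (gd * c) by exact: hh.
  by apply: is_derive_eq; rewrite /GRing.scale/= ?mulr0 ?addr0 exprSr; ring.
have E n : derive1n n (fun x => f (c * x + d)) =
    (fun x => c ^+ n * derive1n n f (c * x + d)).
  elim: n => [|n IHn]; first by apply/funext => x; rewrite !derive1n0 mul1r.
  rewrite derive1nS IHn; apply/funext => x; rewrite derive1E.
  by have h := dn n x; exact: derive_val.
by move=> n x; rewrite E; have [] := dn n x.
Qed.

Lemma smoothB (f g : R -> R) : smooth f -> smooth g ->
  smooth (fun x => f x - g x).
Proof.
move=> sf sg.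
have dn n (x : R) : is_derive x 1 (fun x => derive1n n f x - derive1n n g x)
    (derive1n n.+1 f x - derive1n n.+1 g x).
  have hf := smooth_is_derive n x sf; have hg := smooth_is_derive n x sg.
  exact: is_deriveB.
have E n : derive1n n (fun x => f x - g x) =
    (fun x => derive1n n f x - derive1n n g x).
  elim: n => [|n IHn]; first by [].
  rewrite derive1nS IHn; apply/funext => x; rewrite derive1E.
  by have h := dn n x; exact: derive_val.
by move=> n x; rewrite E; have [] := dn n x.
Qed.

Lemma derive1n_support (f : R -> R) (lo hi : R) n :
  (forall x, x < lo -> f x = 0) -> (forall x, hi < x -> f x = 0) ->
  (forall x, x < lo -> derive1n n f x = 0) /\ (forall x, hi < x -> derive1n n f x = 0).
Proof.
move=> flo fhi; elim: n => [|n [IHlo IHhi]]; first by [].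
have dz (x : R) : (\forall y \near x, 0 = derive1n n f y) -> derive1n n.+1 f x = 0.
  move=> h; rewrite derive1nS derive1E.
  have h2 : is_derive x 1 (derive1n n f) 0.
    by apply: (@near_eq_is_derive _ _ _ (cst 0)).
  exact: derive_val.
split => x hx; apply: dz.
- near=> y; rewrite IHlo//; near: y; exact: lt_nbhsl.
- near=> y; rewrite IHhi//; near: y; exact: lt_nbhsr.
Unshelve. all: by end_near. Qed.

Lemma schwartz_of_support (f : R -> R) (lo hi : R) : lo <= hi -> smooth f ->
  (forall x, x < lo -> f x = 0) -> (forall x, hi < x -> f x = 0) -> schwartz f.
Proof.
move=> lohi sf flo fhi; split => // m n.
have [nlo nhi] := derive1n_support n flo fhi.
pose g (x : R) : R := `|x ^+ m * derive1n n f x|.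
have cg : {within `[lo, hi], continuous g}.
  apply: continuous_subspaceT => x.
  apply: (@continuous_comp R R R (fun x => x ^+ m * derive1n n f x) Num.norm); last first.
    exact: norm_continuous.
  apply: cvgM; first exact: exprn_continuous.
  apply/differentiable_continuous/derivable1_diffP; exact: sf.
have [c _ Hc] := EVT_max lohi cg.
exists (g c) => x.
have [xlo|lox] := ltP x lo; first by rewrite nlo// mulr0 normr0 normr_ge0.
have [hix|xhi] := ltP hi x; first by rewrite nhi// mulr0 normr0 normr_ge0.
by apply: Hc; rewrite in_itv/= lox.
Qed.

Lemma closure_support_sub (f : R -> R) (lo hi : R) :
  (forall x, x < lo -> f x = 0) -> (forall x, hi < x -> f x = 0) ->
  closure [set x | f x != 0] `<=` `[lo, hi].
Proof.
move=> flo fhi.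
have /closure_id -> : closed [set` `[lo, hi]] by exact: itv_closed.
apply: closureS => x /= fx; rewrite in_itv/=; apply/andP; split.
- by rewrite leNgt; apply/negP => /flo fx0; rewrite fx0 eqxx in fx.
- by rewrite leNgt; apply/negP => /fhi fx0; rewrite fx0 eqxx in fx.
Qed.

Lemma compact_closure_support (f : R -> R) (lo hi : R) :
  (forall x, x < lo -> f x = 0) -> (forall x, hi < x -> f x = 0) ->
  compact (closure [set x | f x != 0]).
Proof.
move=> flo fhi; apply: (@subclosed_compact _ _ [set` `[lo, hi]]).
- exact: closed_closure.
- exact: segment_compact.
- exact: closure_support_sub.
Qed.

(** The argument is (x - a) / e, in the affine form of [smooth_affine]. There is no factor 1/e, so
    the integral is of order e. *)
Definition mollifier (e a x : R) : R := smooth_bump (e^-1 * x - a / e).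

Lemma mollifier_ge0 e a x : 0 <= mollifier e a x.
Proof. exact: smooth_bump_ge0. Qed.

Lemma mollifier_le1 e a x : mollifier e a x <= 1.
Proof. exact: smooth_bump_le1. Qed.

Lemma mollifier_argE (e a x : R) : e^-1 * x - a / e = (x - a) / e.
Proof. by rewrite mulrBl mulrC. Qed.

Lemma mollifier_out (e a x : R) : 0 < e -> e <= `|x - a| -> mollifier e a x = 0.
Proof.
move=> e0 xa; rewrite /mollifier mollifier_argE /smooth_bump bumpf_out//.
by rewrite normrM normfV (gtr0_norm e0) ler_pdivlMr// mul1r.
Qed.

Lemma continuous_mollifier (e a : R) : continuous (mollifier e a).
Proof.
move=> x; apply: (@continuous_comp R R R (fun x => e^-1 * x - a / e) smooth_bump).
  by apply: cvgB; [apply: cvgMr; exact: cvg_id|exact: cvg_cst].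
exact: continuous_smooth_bump.
Qed.

Lemma mollifier_integralE (e a b : R) :
  (\int[mu]_y (mollifier e a y)%:E = \int[mu]_y (mollifier e b y)%:E)%E.
Proof.
have H c : (\int[mu]_y (mollifier e c y)%:E = \int[mu]_y (mollifier e 0 y)%:E)%E.
  rewrite -(integral_shift c (@continuous_mollifier e 0) (mollifier_ge0 e 0)).
  apply: eq_integral => y _; congr EFin; rewrite /mollifier.
  by rewrite !mollifier_argE subr0.
by rewrite H [RHS]H.
Qed.

Lemma mollifier_integral_ge (e a : R) : 0 < e ->
  ((expR (- 2) * e)%:E <= \int[mu]_y (mollifier e a y)%:E)%E.
Proof.
move=> e0; pose I := [set` `[a - e / 2, a + e / 2]] : set R.
have mI : measurable I by exact: measurable_itv.
have mm : measurable_fun setT (mollifier e a).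
  exact: continuous_measurable_fun (@continuous_mollifier e a).
apply: (@le_trans _ _ (\int[mu]_(y in I) (mollifier e a y)%:E)%E); last first.
  apply: ge0_subset_integral => //; first exact/measurable_EFinP.
  by move=> y _; rewrite lee_fin mollifier_ge0.
apply: (@le_trans _ _ (\int[mu]_(y in I) (cst (expR (- 2))%:E y))%E).
  have e2 : a - e / 2 < a + e / 2 by lra.
  have muI : mu I = e%:E.
    rewrite /I lebesgue_measure_itv/= lte_fin e2 -EFinB; congr EFin; lra.
  by rewrite integral_cst//= [X in (_ <= _ * X)%E]muI EFinM.
apply: ge0_le_integral => //.
- by move=> y _; rewrite lee_fin expR_ge0.
- by apply/measurable_EFinP; exact: measurable_funTS.
- move=> y; rewrite /I/= in_itv/= => /andP[y1 y2].
  rewrite lee_fin /mollifier; apply: smooth_bump_ge.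
  rewrite mollifier_argE normrM normfV (gtr0_norm e0) ler_pdivrMr//.
  by rewrite ler_norml; apply/andP; split; lra.
Qed.

Lemma mollifier_decay (e a x : R) : 0 < e ->
  `|mollifier e a x| * (1 + x ^+ 2) <= 1 + (`|a| + e) ^+ 2.
Proof.
move=> e0; have [xa|xa] := ltP `|x - a| e; last first.
  by rewrite mollifier_out// normr0 mul0r addr_ge0// sqr_ge0.
rewrite ger0_norm ?mollifier_ge0// (@le_trans _ _ (1 + x ^+ 2))//.
  by rewrite ler_piMl ?mollifier_le1// addr_ge0// sqr_ge0.
rewrite lerD2l -[x ^+ 2]real_normK ?num_real// ler_sqr ?nnegrE ?addr_ge0 ?(ltW e0)//.
rewrite -[x](subrK a) (le_trans (ler_normD _ _))// addrC lerD2l ltW//.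
Qed.

(* The test function is the difference of the two primitives of the mollifiers:
   it is compactly supported because both mollifiers have the same integral. *)
Lemma vanishes_on_mollifier (p : R) (f : (R -> R) -> R) (F : R -> R) (U : set R)
    (a b e : R) : 1 <= p -> primitive p%:E f F -> vanishes_on f U -> 0 < e ->
  (forall x, Num.min a b - e <= x <= Num.max a b + e -> U x) ->
  \int[mu]_x (F x * mollifier e a x) = \int[mu]_x (F x * mollifier e b x).
Proof.
move=> p1 [FLp fF] fU e0 sub.
have en0 : e != 0 by rewrite gt_eqF.
pose phi x := bump_primitive (e^-1 * x - a / e) - bump_primitive (e^-1 * x - b / e).
have sphi : smooth phi by apply: smoothB; apply: smooth_affine; exact: smooth_bump_primitive.
have flo x : x < Num.min a b - e -> phi x = 0.
  move=> hx; have ha : x < a - e by rewrite (lt_le_trans hx)// lerD2r ge_min lexx.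
  have hb : x < b - e by rewrite (lt_le_trans hx)// lerD2r ge_min lexx orbT.
  by rewrite /phi !mollifier_argE !bump_primitive_left ?subrr// ler_pdivrMr//; lra.
have fhi x : Num.max a b + e < x -> phi x = 0.
  move=> hx; have ha : a + e < x by rewrite (le_lt_trans _ hx)// lerD2r le_max lexx.
  have hb : b + e < x by rewrite (le_lt_trans _ hx)// lerD2r le_max lexx orbT.
  by rewrite /phi !mollifier_argE !bump_primitive_right ?subrr// ler_pdivlMr//; lra.
have lohi : Num.min a b - e <= Num.max a b + e.
  have : Num.min a b <= Num.max a b by rewrite ge_min !le_max lexx.
  by lra.
have schphi := schwartz_of_support lohi sphi flo fhi.
have phi0 : f phi = 0.
  apply: fU => //; first exact: (compact_closure_support flo fhi).
  by move=> x /(closure_support_sub flo fhi); rewrite /= in_itv/=; exact: sub.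
have dphi : derive1 phi = (fun x => e^-1 * (mollifier e a x - mollifier e b x)).
  apply/funext => x; rewrite derive1E.
  have haff c : is_derive x 1 (fun x : R => e^-1 * x - c / e) e^-1.
    by apply: is_derive_eq; rewrite /GRing.scale/= ?mulr0 ?add0r ?subr0 ?addr0 mulr1.
  have hd c : is_derive x 1 (fun x => bump_primitive (e^-1 * x - c / e)) (mollifier e c x * e^-1).
    exact: (@is_derive1_comp _ _ (fun x => e^-1 * x - c / e) x _ _
      (is_derive_bump_primitive _) (haff c)).
  have ha := hd a; have hb := hd b.
  have h : is_derive x 1 phi (mollifier e a x * e^-1 - mollifier e b x * e^-1).
    exact: is_deriveB.
  by rewrite derive_val mulrBr ![e^-1 * _]mulrC.
have [D D0 HD] := Lfun_schwartz_decay p1 FLp.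
have iFm c : mu.-integrable setT (fun x => (F x * mollifier e c x)%:E).
  apply: (HD _ (1 + (`|c| + e) ^+ 2) _ _ _).1.
  - by rewrite addr_ge0// sqr_ge0.
  - exact: continuous_measurable_fun (@continuous_mollifier e c).
  - by move=> x; exact: mollifier_decay.
have := fF _ schphi; rewrite phi0 /dist_deriv /dist_of_fun dphi => /esym/eqP.
rewrite oppr_eq0.
under eq_Rintegral do rewrite mulrCA mulrBr.
have iD : mu.-integrable setT
    (EFin \o (fun x => F x * mollifier e a x - F x * mollifier e b x)).
  exact: integrableB (iFm a) (iFm b).
rewrite (@RintegralZl _ _ _ mu setT _ e^-1 measurableT iD).
rewrite mulf_eq0 invr_eq0 (negbTE en0)/= (RintegralB measurableT (iFm a) (iFm b)).
by rewrite subr_eq0 => /eqP.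
Qed.

End test_functions.

(** * Values of the primitive at Lebesgue points *)

Section support.
Context {R : realType}.
Notation mu := (@lebesgue_measure R).

(** The splitting of powers with l = 1 gives |F| <= |F|^p + 1, which is integrable on compact
    sets. *)
Lemma Lfun_locally_integrable (p : R) (F : R -> R) : 1 <= p -> F \in Lfun mu p%:E ->
  locally_integrable setT F.
Proof.
move=> p1 FLp; have [mF iF] := Lfun_integral_powR p1 FLp.
have mFp : measurable_fun setT (fun y => `|F y| `^ p).
  by apply: (measurableT_comp (measurable_powR p)); exact: measurableT_comp.
split => //; first exact: openT.
move=> K _ cK.
have mK : measurable K by exact: compact_measurable.
have mFK : measurable_fun K (fun y => `|F y|).
  by apply: measurable_funTS; exact: measurableT_comp.
apply: (@le_lt_trans _ _ (\int[mu]_(x in K) ((`|F x| `^ p)%:E + (cst 1%E x)))%E).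
  apply: ge0_le_integral => //.
  - exact/measurable_EFinP.
  - apply: emeasurable_funD => //; apply/measurable_EFinP; exact: measurable_funTS.
  - move=> x _; rewrite /= lee_fin.
    by have := le_powR_split p1 (normr_ge0 (F x)) ltr01; rewrite powR1 mul1r.
rewrite ge0_integralD//; last by apply/measurable_EFinP; exact: measurable_funTS.
rewrite lte_add_pinfty//.
- apply: (@le_lt_trans _ _ (\int[mu]_x (`|F x| `^ p)%:E)%E).
    by apply: ge0_subset_integral => //; exact/measurable_EFinP.
  by rewrite iF ltry.
- by rewrite integral_cst// mul1e; exact: compact_finite_measure.
Qed.

Lemma integrable_mollifier (a e : R) : 0 < e ->
  mu.-integrable setT (EFin \o mollifier e a).
Proof.
move=> e0; have := @integrable_indic_itv R (a - e) (a + e) true false.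
apply: le_integrable => //.
  by apply/measurable_EFinP; exact: continuous_measurable_fun (@continuous_mollifier _ e a).
move=> x _ /=; rewrite lee_fin indicE ger0_norm ?mollifier_ge0//.
case: (boolP (_ \in _)) => [_|xI]; first by rewrite normr1 mollifier_le1.
rewrite normr0 mollifier_out// leNgt; apply/negP => x1.
by move/negP: xI; apply; rewrite inE/= in_itv/= -ler_distl ltW.
Qed.

(** [davg F a e] is the mean of |F - F(a)| over a ball of length 2e; the mollifier is at most 1 and
    vanishes off that ball. *)
Lemma mollifier_oscillation (F : R -> R) (a e : R) : 0 < e ->
  measurable_fun setT F ->
  (\int[mu]_y (`|(F a - F y) * mollifier e a y|)%:E <= (2 * e)%:E * davg F a e)%E.
Proof.
move=> e0 mF.
have mB : measurable (ball a e : set R) by exact: measurable_ball.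
have mD : measurable_fun setT (fun y => `|F a - F y|).
  by apply: measurableT_comp => //; exact: measurable_funB.
have -> : ((2 * e)%:E * davg F a e = \int[mu]_(y in ball a e) (`|F a - F y|)%:E)%E.
  rewrite /davg /iavg lebesgue_measure_ball ?(ltW e0)// -[e *+ 2]mulr_natl muleA.
  have e2 : 2 * e != 0 by rewrite mulf_neq0 ?gt_eqF.
  rewrite inver (negbTE e2) -EFinM mulfV// mul1e.
  by apply: eq_integral => y _; rewrite /= distrC.
rewrite [leRHS]integral_mkcond; apply: ge0_le_integral => //.
- apply/measurable_EFinP; apply: measurableT_comp => //; apply: measurable_funM.
    exact: measurable_funB.
  exact: continuous_measurable_fun (@continuous_mollifier _ e a).
- apply/(measurable_restrictT _ mB); apply/measurable_EFinP; exact: measurable_funTS.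
- move=> y _; rewrite patchE; case: ifPn => [_|].
    rewrite lee_fin normrM ler_piMr// ger0_norm ?mollifier_ge0 ?mollifier_le1//.
  rewrite notin_setE /ball/= => /negP; rewrite -leNgt distrC => h.
  by rewrite mollifier_out// mulr0 normr0.
Qed.

Lemma mollifier_mean_close (F : R -> R) (c e eta : R) : 0 < e ->
  measurable_fun setT F ->
  mu.-integrable setT (fun x => (F x * mollifier e c x)%:E) ->
  (davg F c e <= eta%:E)%E ->
  `|F c * \int[mu]_y mollifier e c y - \int[mu]_y (F y * mollifier e c y)| <= 2 * e * eta.
Proof.
move=> e0 mF iFm h.
have mm : measurable_fun setT (mollifier e c).
  exact: continuous_measurable_fun (@continuous_mollifier _ e c).
have osc : (\int[mu]_y (`|(F c - F y) * mollifier e c y|)%:E <= (2 * e * eta)%:E)%E.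
  apply: (le_trans (mollifier_oscillation c e0 mF)).
  have e20 : (0 <= (2 * e)%:E)%E by rewrite lee_fin mulr_ge0 ?(ltW e0).
  by rewrite [leRHS]EFinM; exact: lee_wpmul2l.
have mFm : measurable_fun setT (fun y => (F c - F y) * mollifier e c y).
  by apply: measurable_funM => //; exact: measurable_funB.
have iosc : mu.-integrable setT (fun y => ((F c - F y) * mollifier e c y)%:E).
  apply/integrableP; split; first exact/measurable_EFinP.
  by apply: (le_lt_trans osc); rewrite ltry.
have im := integrable_mollifier c e0.
have iZ : mu.-integrable setT (EFin \o (fun y => F c * mollifier e c y)).
  have := integrableZl measurableT (F c) im.
  by apply: eq_integrable => [|y _]; [exact: measurableT|rewrite /= EFinM].
rewrite -(@RintegralZl _ _ _ mu setT _ (F c) measurableT im).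
rewrite -(RintegralB measurableT iZ iFm).
under eq_Rintegral do rewrite -mulrBl.
rewrite -lee_fin (EFin_normr_Rintegral measurableT iosc).
apply: (le_trans _ osc); apply: le_abse_integral; first exact: measurableT.
exact/measurable_EFinP.
Qed.

(** The two mollified integrals of F are equal, both mollifiers have the same integral I, and I is
    at least a multiple of the radius. At Lebesgue points each error is a small multiple of the
    radius too, so division by I leaves |F(a) - F(b)| arbitrarily small. *)
Lemma lebesgue_pt_eq (p : R) (f : (R -> R) -> R) (F : R -> R) (U : set R)
    (a b e0 : R) : 1 <= p -> primitive p%:E f F -> vanishes_on f U -> 0 < e0 ->
  (forall x, Num.min a b - e0 <= x <= Num.max a b + e0 -> U x) ->
  lebesgue_pt F a -> lebesgue_pt F b -> F a = F b.
Proof.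
move=> p1 pfF fU e00 sub La Lb.
have [mF _] := Lfun_integral_powR p1 pfF.1.
have k0 : 0 < expR (- 2) :> R by exact: expR_gt0.
suff main : forall d, 0 < d -> `|F a - F b| <= d.
  apply/eqP; rewrite -subr_eq0 -normr_le0; apply/ler_addgt0Pr => d d0.
  by rewrite add0r main.
(* Solves 4 e eta = exp(-2) e d, where exp(-2) e is the lower bound of I at radius e and 4 e eta the
   sum of the two errors. *)
move=> d d0; pose eta := expR (- 2) * d / 4.
have eta0 : 0 < eta by rewrite divr_gt0 ?mulr_gt0.
have near_le c : lebesgue_pt F c -> \forall e \near 0^'+, (davg F c e <= eta%:E)%E.
  move=> /fine_cvgP[Fn /cvgr0Pnorm_le /(_ _ eta0)].
  apply: filterS2 Fn => e fn; rewrite /= => h.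
  by rewrite -(fineK fn) lee_fin (le_trans (ler_norm _) h).
have [e /= [[ea eb] [e_gt0 ee0]]] : exists e : R, (((davg F a e <= eta%:E)%E /\
     (davg F b e <= eta%:E)%E) /\ (0 < e /\ e < e0)).
  apply: (@filter_ex _ (0^'+ : set_system R)); near=> e; split; split.
  - by near: e; exact: near_le.
  - by near: e; exact: near_le.
  - by near: e; exact: nbhs_right_gt.
  - by near: e; exact: nbhs_right_lt.
have FE : \int[mu]_x (F x * mollifier e a x) = \int[mu]_x (F x * mollifier e b x).
  apply: (vanishes_on_mollifier p1 pfF fU e_gt0) => x /andP[h1 h2].
  by apply: sub; rewrite (le_trans _ h1) ?(le_trans h2)//; lra.
have [D D0 HD] := Lfun_schwartz_decay p1 pfF.1.
have mm c : measurable_fun setT (mollifier e c).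
  exact: continuous_measurable_fun (@continuous_mollifier _ e c).
have iFm c : mu.-integrable setT (fun x => (F x * mollifier e c x)%:E).
  have C0 : 0 <= 1 + (`|c| + e) ^+ 2 by rewrite addr_ge0 ?sqr_ge0.
  exact: (HD _ _ C0 (mm c) (fun x => mollifier_decay c x e_gt0)).1.
clear D D0 HD.
pose I := \int[mu]_y mollifier e a y.
have IE : \int[mu]_y mollifier e b y = I.
  by rewrite /I /Rintegral (mollifier_integralE e a b).
have I_ge : expR (- 2) * e <= I.
  rewrite -lee_fin /I /Rintegral fineK; last first.
    exact: integrable_fin_num (integrable_mollifier a e_gt0).
  exact: mollifier_integral_ge.
have := mollifier_mean_close e_gt0 mF (iFm b) eb; rewrite IE -FE => hb.
have := mollifier_mean_close e_gt0 mF (iFm a) ea; rewrite -/I => ha.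
have : `|(F a - F b) * I| <= 4 * e * eta.
  set J := \int[mu]_y _ in ha hb.
  have -> : (F a - F b) * I = (F a * I - J) - (F b * I - J) by ring.
  apply: (le_trans (ler_normB _ _)).
  by apply: (le_trans (lerD ha hb)); rewrite le_eqVlt; apply/orP; left; apply/eqP; ring.
have I0 : 0 < I by apply: lt_le_trans I_ge; rewrite mulr_gt0.
rewrite normrM (gtr0_norm I0) => h.
have : `|F a - F b| * (expR (- 2) * e) <= expR (- 2) * e * d.
  apply: (@le_trans _ _ (`|F a - F b| * I)); first by rewrite ler_wpM2l.
  by apply: (le_trans h); rewrite /eta le_eqVlt; apply/orP; left; apply/eqP; field.
by rewrite mulrC ler_pM2l; last exact: mulr_gt0.
Unshelve. all: by end_near. Qed.

Lemma lebesgue_pt_between (F : R -> R) (a b : R) : locally_integrable setT F ->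
  a < b -> exists c, [/\ a < c, c < b & lebesgue_pt F c].
Proof.
move=> /lebesgue_differentiation[N [mN N0 sub]] ab; apply: contrapT => nc.
suff : (mu [set` `]a, b[] <= mu N)%E.
  by rewrite N0 lebesgue_measure_itv/= lte_fin ab -EFinB lee_fin leNgt subr_gt0 ab.
apply: le_measure; rewrite ?inE// => x; rewrite /= in_itv/= => /andP[ax xb].
by apply: sub => /= Lx; apply: nc; exists x.
Qed.

(** f is known to vanish only locally, so the equality is propagated along [a, b] by a supremum
    argument. The supremum s need not be a Lebesgue point; nearby Lebesgue points, which are dense,
    take its place. *)
Lemma lebesgue_pt_const (p : R) (f : (R -> R) -> R) (F : R -> R) (V : set R)
    (a b : R) : 1 <= p -> primitive p%:E f F ->
  (forall x, a <= x <= b -> V x) ->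
  (forall x, V x -> exists U, [/\ open U, U x & vanishes_on f U]) ->
  a < b -> lebesgue_pt F a -> lebesgue_pt F b -> F a = F b.
Proof.
move=> p1 pfF abV locV ab La Lb.
have liF := Lfun_locally_integrable p1 pfF.1.
pose S := [set x | a <= x <= b /\ forall y, a <= y <= x -> lebesgue_pt F y -> F y = F a].
have Sa : S a.
  split; first by rewrite lexx ltW.
  by move=> y ay _; have -> : y = a by apply/eqP; rewrite eq_le andbC.
have Sb : ubound S b by move=> x [/andP[]].
have supS : has_sup S by split; [exists a|exists b].
pose s := sup S.
have as_ : a <= s by apply: ub_le_sup => //; exists b.
have sb : s <= b by apply: ge_sup => //; exists a.
have asb : a <= s <= b by rewrite as_ sb.
have [U [oU Us fU]] := locV s (abV s asb).
have [d /= d0 Hd] : exists2 d : R, 0 < d & forall x, `|s - x| < d -> U x.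
  by have := open_nbhs_nbhs (conj oU Us) => -[d /= d0 Hd]; exists d.
have d2 : 0 < d / 2 by rewrite divr_gt0.
have locF y z : s - d / 2 < y -> y < s + d / 2 -> s - d / 2 < z -> z < s + d / 2 ->
    lebesgue_pt F y -> lebesgue_pt F z -> F y = F z.
  move=> y1 y2 z1 z2; apply: (@lebesgue_pt_eq p f F U y z (d / 2)) => // x /andP[h1 h2].
  apply: Hd; rewrite ltr_norml; apply/andP; split.
  - have : Num.max y z < s + d / 2 by rewrite gt_max y2.
    lra.
  - have : s - d / 2 < Num.min y z by rewrite lt_min y1.
    lra.
(* A Lebesgue point less than d/2 to the left of s where the equality is already known: a itself if
   it is that close, otherwise one below an element of S close to s. *)
have [y0 [y01 y02 Ly0 Fy0]] : exists y, [/\ s - d / 2 < y, y <= s, lebesgue_pt F y & F y = F a].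
  have [sa|sa] := ltP (s - d / 2) a; first by exists a.
  have [x Sx sx] := sup_adherent d2 supS.
  have [y [y1 y2 Ly]] := lebesgue_pt_between liF sx.
  exists y; split => //.
    by apply: ltW; apply: (lt_le_trans y2); apply: ub_le_sup => //; exists b.
  apply: Sx.2 => //; apply/andP; split; last exact: ltW.
  by apply: ltW; exact: le_lt_trans y1.
have ext x : x < s + d / 2 -> forall y, a <= y <= x -> lebesgue_pt F y -> F y = F a.
  move=> xs y /andP[ay yx] Ly.
  have [sy|ys] := ltP (s - d / 2) y.
    by rewrite -Fy0; apply: locF => //; [exact: le_lt_trans yx xs|lra].
  have [z Sz sz] := sup_adherent d2 supS.
  apply: Sz.2 => //; rewrite ay/=; apply: (le_trans ys); exact: ltW.
have [bs|sb'] := ltP b (s + d / 2).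
  by apply/esym/(ext b) => //; rewrite lexx ltW.
(* Here s + d/2 <= b, so s + d/4 would lie in S, above its supremum. *)
exfalso; pose x := s + d / 4.
have d4 : 0 < d / 4 by rewrite divr_gt0.
have : x <= s.
  apply: ub_le_sup; first by exists b.
  split; last by apply: ext; rewrite /x ltrD2l; lra.
  by apply/andP; split; rewrite /x; lra.
by rewrite /x; lra.
Qed.

(** (n + 1) |c|^p is at most the integral of |F|^p, for every n. The position of the intervals is
    free, so that both half-lines are covered. *)
Lemma Lfun_const_eq0 (p : R) (F : R -> R) (c : R) (u : nat -> R) : 1 <= p ->
  F \in Lfun mu p%:E ->
  (forall n, {ae mu, forall y, u n <= y <= u n + n.+1%:R -> F y = c}) -> c = 0.
Proof.
move=> p1 FLp Fc; have [mF iF] := Lfun_integral_powR p1 FLp.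
have p0 : 0 < p by apply: lt_le_trans p1.
have mFp : measurable_fun setT (fun y => `|F y| `^ p).
  by apply: (measurableT_comp (measurable_powR p)); exact: measurableT_comp.
apply/eqP; rewrite -normr_eq0; apply/negP => /negP c0.
have cp : 0 < `|c| `^ p by rewrite powR_gt0// lt_neqAle eq_sym c0/=.
set N := fine _ in iF.
have bd n : n.+1%:R * `|c| `^ p <= N `^ p.
  rewrite -lee_fin -iF; pose I := [set` `[u n, u n + n.+1%:R]] : set R.
  have mI : measurable I by exact: measurable_itv.
  apply: (@le_trans _ _ (\int[mu]_(y in I) (`|F y| `^ p)%:E)%E); last first.
    by apply: ge0_subset_integral => //; exact/measurable_EFinP.
  apply: (@le_trans _ _ (\int[mu]_(y in I) (cst (`|c| `^ p)%:E y))%E).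
    have muI : mu I = n.+1%:R%:E.
      by rewrite /I lebesgue_measure_itv/= lte_fin ltrDl ltr0n/= -EFinB addrAC subrr add0r.
    by rewrite integral_cst//= [X in (_ <= _ * X)%E]muI -EFinM mulrC.
  apply: ae_ge0_le_integral => //.
  - by move=> y _; rewrite lee_fin powR_ge0.
  - by apply/measurable_EFinP; exact: measurable_funTS.
  - have [Z [mZ Z0 sub]] := Fc n; exists Z; split => // y /= hy.
    apply: sub => /= Fy; apply: hy; rewrite /I/= in_itv/= => yI.
    by rewrite Fy.
have := bd (Num.truncn (N `^ p / `|c| `^ p)).
by rewrite -ler_pdivlMr// leNgt truncnS_gt.
Qed.

Lemma primitive_eq0_off_support (p : R) (f : (R -> R) -> R) (F : R -> R) (rad : R) :
  1 <= p -> primitive p%:E f F -> 0 <= rad ->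
  dist_support f `<=` `[- rad, rad] ->
  {ae mu, forall x, rad < `|x| -> F x = 0}.
Proof.
move=> p1 pfF rad0 supp.
have liF := Lfun_locally_integrable p1 pfF.1.
have locV x : rad < `|x| -> exists U, [/\ open U, U x & vanishes_on f U].
  move=> rx; apply: contrapT => nU.
  have : dist_support f x.
    by move=> U oU Ux fU; apply: nU; exists U.
  move=> /supp; rewrite /= in_itv/= -ler_norml leNgt rx//.
have LebT := lebesgue_differentiation liF.
(* V will be either of the half-lines x > rad and x < -rad. F takes the value F(a) at all Lebesgue
   points of V, hence almost everywhere on arbitrarily long intervals in V, which forces F(a) =
   0. *)
have main (a : R) (u : nat -> R) (V : set R) : lebesgue_pt F a -> V a ->
    (forall x, V x -> rad < `|x|) ->
    (forall x y z, V x -> V z -> x <= y <= z -> V y) ->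
    (forall n x, u n <= x <= u n + n.+1%:R -> V x) -> F a = 0.
  move=> La Va Vr Vc uV; apply: (Lfun_const_eq0 (u := u) p1 pfF.1) => n.
  have [Z [mZ Z0 sub]] := LebT; exists Z; split => // y /= hy.
  apply: sub => /= Ly; apply: hy => /uV Vy.
  have locV' x : V x -> exists U, [/\ open U, U x & vanishes_on f U].
    by move=> /Vr; exact: locV.
  have [ay|ya|->//] := ltgtP a y.
  - apply/esym; apply: (lebesgue_pt_const p1 pfF _ locV' ay) => // x.
    exact: Vc.
  - apply: (lebesgue_pt_const p1 pfF _ locV' ya) => // x.
    exact: Vc.
have [Z [mZ Z0 sub]] := LebT; exists Z; split => // y /= hy.
apply: sub => /= Ly; apply: hy => ry.
have [y0|y0] := leP 0 y.
  rewrite ger0_norm// in ry.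
  apply: (main y (fun=> y) [set x | rad < x]) => //.
  - by move=> x /= rx; rewrite (lt_le_trans rx)// ler_norm.
  - by move=> x w z /= rx _ /andP[xw _]; exact: lt_le_trans xw.
  - by move=> n x /andP[yx _] /=; exact: lt_le_trans yx.
rewrite ltr0_norm// in ry.
apply: (main y (fun n => y - n.+1%:R) [set x | rad < - x]) => //.
- by move=> x /= rx; rewrite -normrN (lt_le_trans rx)// ler_norm.
- by move=> x w z /= _ rz /andP[_ wz]; rewrite (lt_le_trans rz)// lerN2.
- move=> n x /andP[_]; rewrite subrK => xy /=; rewrite (lt_le_trans ry)// lerN2//.
Qed.

End support.

(** * Gaussian tails *)

(* The q-th root of the bound of the L^q norm of Theta_t' over x - [-R, R]. *)
Lemma tail_constantE {R : realType} (p t X e : R) : 1 < p -> 0 < t -> 0 <= X ->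
  let q := p / (p - 1) in
  (((4 * Num.sqrt pi)^-1 * t `^ (- (3 / 2))) `^ q *
     ((3 / 2 * X) `^ (q - 1) * (2 * t / q * expR (q * e)))) `^ q^-1 =
  M_const p * (X `^ p^-1 * expR e * t `^ (- (2^-1 + p^-1))).
Proof.
move=> p1 t0 X0 q; have pm1 : 0 < p - 1 by rewrite subr_gt0.
have p0 : 0 < p by apply: lt_trans p1.
have pn0 : p != 0 by rewrite gt_eqF.
have pm1n0 : p - 1 != 0 by rewrite gt_eqF.
(* Zero is not an exponential, so this case is settled apart: X occurs with the positive exponents q
   - 1 = 1/(p - 1) and 1/p, and both sides vanish. *)
have [->|Xn0] := eqVneq X 0.
  have q1 : q - 1 = (p - 1)^-1 by rewrite /q; field.
  rewrite mulr0 q1 !powR0 ?invr_eq0// ?mul0r ?mulr0 ?mul0r ?mulr0 ?powR0//.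
  by rewrite invr_eq0 mulf_neq0// invr_eq0.
have {Xn0}X0 : 0 < X by rewrite lt_neqAle eq_sym Xn0.
have s0 : 0 < Num.sqrt pi :> R by rewrite sqrtr_gt0 pi_gt0.
rewrite /M_const (gt_eqF p1).
have P (a : R) : 0 < a -> exists b, a = expR b by exists (ln a); rewrite lnK.
(* All the factors are powers of positive reals, hence exponentials: the
   identity reduces to one between the exponents. *)
have E (a s l b y c d : R) :
  0 < a -> 0 < s -> 0 < l -> 0 < b -> 0 < y -> 0 < c -> 0 < d ->
  (((a * a * s)^-1 * l `^ (- (3 / 2))) `^ q *
     ((b / a * y) `^ (q - 1) * (a * l / (c / d) * expR (q * e)))) `^ q^-1 =
  b `^ p^-1 * d `^ (1 - p^-1) / (a `^ (1 + 2 / p) * s * c `^ (1 - p^-1)) *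
  (y `^ p^-1 * expR e * l `^ (- (2^-1 + p^-1))).
  move=> /P[{}a ->] /P[{}s ->] /P[{}l ->] /P[{}b ->] /P[{}y ->] /P[{}c ->] /P[{}d ->].
  rewrite -!expRM -!(expRD, expRN) -!expRM -!(expRD, expRN) -!expRM.
  by congr expR; rewrite /q; field; rewrite pn0.
rewrite -(E 2 _ t 3 X p (p - 1) (ltr0Sn _ _) s0 t0 (ltr0Sn _ _) X0 p0 pm1).
by have -> : 4 = 2 * 2 :> R by ring.
Qed.

Section tail.
Context {R : realType}.
Notation mu := (@lebesgue_measure R).
Variables (F : R -> R) (t rad : R).
Hypotheses (t0 : 0 < t) (rad0 : 0 <= rad).
Hypothesis Fsupp : {ae mu, forall y, rad < `|y| -> F y = 0}.
Notation K := (derive1 (@heat_kernel R t)).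
Let C : R := (4 * Num.sqrt pi)^-1 * t `^ (- (3 / 2)).

Let spi0 : 0 < Num.sqrt pi :> R.
Proof. by rewrite sqrtr_gt0 pi_gt0. Qed.

Let C0 : 0 < C.
Proof. by rewrite mulr_gt0 ?powR_gt0// invr_gt0 mulr_gt0. Qed.

Let normr_K u : `|K u| = C * (`|u| * expR (- (u ^+ 2 / (4 * t)))).
Proof.
have st0 : 0 < Num.sqrt t by rewrite sqrtr_gt0.
rewrite normr_derive1_heat_kernel// /heat_kernel /C mulNr powRN.
have -> : t `^ (3 / 2) = t * Num.sqrt t.
  have -> : 3 / 2 = 1 + 2^-1 :> R by field.
  rewrite powRD; last by rewrite (gt_eqF t0) implybT.
  by rewrite powRr1 ?(ltW t0)// powR12_sqrt// ltW.
rewrite sqrtrM ?pi_ge0//.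
by move: (expR _) => e; field; rewrite !gt_eqF.
Qed.

(** Write e^(-z^2/(4t)) as e^d e^(-u^2/(4t)) with d = (u^2 - z^2)/(4t), and use e^d >= 1 + d: then z
    (1 + d) - u is u - z times ((u + z) z - 4t)/(4t), nonnegative as (u + z) z >= 2 z^2 >= 4t. *)
Let gauss_tail (z u : R) : Num.sqrt (2 * t) <= z -> z <= u ->
  u * expR (- (u ^+ 2 / (4 * t))) <= z * expR (- (z ^+ 2 / (4 * t))).
Proof.
move=> hz zu.
have s0 : 0 < Num.sqrt (2 * t) by rewrite sqrtr_gt0 mulr_gt0.
have z0 : 0 < z by apply: lt_le_trans hz.
have z2 : 2 * t <= z ^+ 2.
  rewrite -[X in X <= _](@sqr_sqrtr _ (2 * t)) ?mulr_ge0 ?(ltW t0)//.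
  by rewrite ler_sqr ?nnegrE ?(ltW s0) ?(ltW z0).
have -> : - (z ^+ 2 / (4 * t)) = (u ^+ 2 - z ^+ 2) / (4 * t) + - (u ^+ 2 / (4 * t)).
  by rewrite mulrBl addrAC subrr add0r.
rewrite expRD mulrA ler_wpM2r ?expR_ge0//.
apply: (@le_trans _ _ (z * (1 + (u ^+ 2 - z ^+ 2) / (4 * t)))); last first.
  by rewrite ler_wpM2l ?(ltW z0)// expR_ge1Dx.
rewrite -subr_ge0.
have -> : z * (1 + (u ^+ 2 - z ^+ 2) / (4 * t)) - u =
    (u - z) * (((u + z) * z - 4 * t) / (4 * t)).
  by field; rewrite gt_eqF.
rewrite mulr_ge0 ?subr_ge0// divr_ge0 ?mulr_ge0 ?(ltW t0)//.
rewrite subr_ge0 (@le_trans _ _ (2 * z * z))//.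
  by rewrite -mulrA -expr2; move: z2; lra.
by rewrite ler_wpM2r ?(ltW z0)//; lra.
Qed.

Lemma heat_conv_tail1 x : F \in Lfun mu 1%:E -> rad + Num.sqrt (2 * t) <= `|x| ->
  `|heat_conv F t x| <= (4 * Num.sqrt pi)^-1 * fine (Lp_norm 1%:E F) *
    (`|x| * expR (- (`|x| - rad) ^+ 2 / (4 * t)) * t `^ (- (3 / 2))).
Proof.
move=> FL hx; have p1 : 1 <= 1 :> R by [].
have [mF iF] := Lfun_integral_powR p1 FL.
have kAB := kernel_bound_derive1_heat_kernel t0.
have mK : measurable_fun setT (fun y : R => K (x - y)).
  exact: measurable_shift (kernel_cont kAB).
pose k := C * (`|x| * expR (- (`|x| - rad) ^+ 2 / (4 * t))).
have k0 : 0 <= k by rewrite mulr_ge0 ?(ltW C0)// mulr_ge0 ?expR_ge0.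
set N := fine _ in iF *.
have N0 : 0 <= N by rewrite fine_ge0 ?Lnorm_ge0.
rewrite [leRHS](_ : _ = k * N); last by rewrite /k /C; ring.
apply: (normr_conv_le mF mK _).2.
apply: (@le_trans _ _ (\int[mu]_y (k%:E * (`|F y|)%:E))%E).
  apply: ae_ge0_le_integral => //.
  - apply/measurable_EFinP; apply: measurableT_comp => //; exact: measurable_funM.
  - by move=> y _; rewrite -EFinM lee_fin mulr_ge0.
  - apply: emeasurable_funM => //; apply/measurable_EFinP.
    exact: measurableT_comp.
  - have [Z [mZ Z0 sub]] := Fsupp; exists Z; split => // y /= hy.
    apply: sub => /= Fy; apply: hy => _.
    rewrite -EFinM lee_fin normrM.
    have [/Fy ->|yr] := ltP rad `|y|; first by rewrite normr0 mul0r mulr0.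
    rewrite mulrC ler_wpM2r// normr_K /k ler_wpM2l ?(ltW C0)//.
    have zu : `|x| - rad <= `|x - y|.
      by rewrite (le_trans _ (lerB_dist _ _))// lerD2l lerN2.
    have hz : Num.sqrt (2 * t) <= `|x| - rad by rewrite lerBrDl.
    have := gauss_tail hz zu; rewrite real_normK ?num_real// mulNr => /le_trans; apply.
    (* The factor |x| - rad is enlarged to the |x| of the statement. *)
    by rewrite ler_wpM2r ?expR_ge0// lerBlDr lerDl.
rewrite ge0_integralZl_EFin//; last by apply/measurable_EFinP; exact: measurableT_comp.
rewrite [leRHS]EFinM lee_wpmul2l ?lee_fin//.
have -> : (\int[mu]_y (`|F y|)%:E = \int[mu]_y (`|F y| `^ 1)%:E)%E.
  by apply: eq_integral => y _; rewrite powRr1.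
by rewrite iF powRr1.
Qed.

Let gauss_primitive (q x y : R) : q != 0 ->
  is_derive y 1 (fun y => (2 * t / q) * expR (- (q * (x - y) ^+ 2 / (4 * t))))
    ((x - y) * expR (- (q * (x - y) ^+ 2 / (4 * t)))).
Proof.
move=> q0; apply: is_derive_eq.
rewrite /GRing.scale/=; move: (expR _) => e; field.
by rewrite gt_eqF.
Qed.

Let I := [set` `[- rad, rad]] : set R.

(** For |x| >= 2 rad the sign of x - y is constant on [-rad, rad], so the integrand is plus or minus
    the derivative of a multiple of a Gaussian. The endpoint nearest to x gives the bound; the other
    one contributes a nonpositive term. *)
Let integral_gauss_moment (q x : R) : 0 < q -> 2 * rad <= `|x| ->
  (\int[mu]_(y in I) (`|x - y| * expR (- (q * (x - y) ^+ 2 / (4 * t))))%:E <=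
   (2 * t / q * expR (- (q * (`|x| - rad) ^+ 2 / (4 * t))))%:E)%E.
Proof.
move=> q0 hx.
have c0 : 0 <= 2 * t / q by rewrite divr_ge0 ?mulr_ge0 ?(ltW t0) ?(ltW q0).
(* The interval is then a single point, while the fundamental theorem of calculus is applied on a
   nondegenerate one. *)
have [rE|rn] := eqVneq rad 0.
  by rewrite /I rE oppr0 set_itv1 integral_set1 lee_fin mulr_ge0 ?expR_ge0.
have r0 : 0 < rad by rewrite lt_neqAle eq_sym rn.
have rr : - rad < rad by rewrite gtrN.
pose G y := (2 * t / q) * expR (- (q * (x - y) ^+ 2 / (4 * t))).
have G0 y : 0 <= G y by rewrite mulr_ge0 ?expR_ge0.
have dG (s y : R) : is_derive y 1 (fun y => s * G y)
    (s * ((x - y) * expR (- (q * (x - y) ^+ 2 / (4 * t))))).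
  have h : is_derive y 1 G ((x - y) * expR (- (q * (x - y) ^+ 2 / (4 * t)))).
    by apply: gauss_primitive; rewrite gt_eqF.
  by apply: is_derive_eq; rewrite /GRing.scale/= ?mulr0 ?addr0.
have cG s : continuous (fun y => s * G y).
  by move=> y; apply/differentiable_continuous/derivable1_diffP; have [] := dG s y.
have cexp : continuous (fun y => expR (- (q * (x - y) ^+ 2 / (4 * t)))).
  move=> y; apply/differentiable_continuous/derivable1_diffP.
  have h : is_derive y 1 (fun y => expR (- (q * (x - y) ^+ 2 / (4 * t))))
      (q * (x - y) / (2 * t) * expR (- (q * (x - y) ^+ 2 / (4 * t)))).
    apply: is_derive_eq; rewrite /GRing.scale/=; move: (expR _) => e; field.
    by rewrite gt_eqF.
  by case: h.
have FTC s : (\int[mu]_(y in I)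
      (s * ((x - y) * expR (- (q * (x - y) ^+ 2 / (4 * t)))))%:E =
    (s * G rad - s * G (- rad))%:E)%E.
  rewrite (@continuous_FTC2 _ _ (fun y => s * G y) _ _ rr).
  - by rewrite EFinB.
  - apply: continuous_subspaceT => y; apply: cvgM; first exact: cvg_cst.
    apply: cvgM; last exact: cexp.
    by apply: cvgB; [exact: cvg_cst|exact: cvg_id].
  - split.
    + by move=> y _; have [] := dG s y.
    + by apply: cvg_at_right_filter; exact: cG.
    + by apply: cvg_at_left_filter; exact: cG.
  - by move=> y _; rewrite derive1E; have h := dG s y; exact: derive_val.
have Gle y : `|x| - rad <= `|x - y| ->
    G y <= 2 * t / q * expR (- (q * (`|x| - rad) ^+ 2 / (4 * t))).
  move=> h; rewrite ler_wpM2l// ler_expR lerN2 ler_pM2r ?invr_gt0 ?mulr_gt0//.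
  rewrite ler_pM2l// -[leRHS]real_normK ?num_real// ler_sqr ?nnegrE//.
  by rewrite subr_ge0 (le_trans _ hx)// ler_peMl// ler1n.
have main (s : R) y1 y2 : (forall y, y \in `[- rad, rad] -> `|x - y| = s * (x - y)) ->
    s * G rad - s * G (- rad) = G y1 - G y2 -> `|x| - rad <= `|x - y1| ->
    (\int[mu]_(y in I) (`|x - y| * expR (- (q * (x - y) ^+ 2 / (4 * t))))%:E <=
   (2 * t / q * expR (- (q * (`|x| - rad) ^+ 2 / (4 * t))))%:E)%E.
  move=> hs e h.
  have -> : (\int[mu]_(y in I) (`|x - y| * expR (- (q * (x - y) ^+ 2 / (4 * t))))%:E =
     \int[mu]_(y in I) (s * ((x - y) * expR (- (q * (x - y) ^+ 2 / (4 * t)))))%:E)%E.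
    by apply: eq_integral => y; rewrite inE /I/= => yI; rewrite mulrA -hs.
  by rewrite FTC e lee_fin (le_trans _ (Gle _ h))// lerBlDr lerDl.
have [x0|x0] := leP 0 x.
  rewrite ger0_norm// in hx; apply: (main 1 rad (- rad)); rewrite ?mul1r//.
    move=> y; rewrite in_itv/= => /andP[y1 y2]; rewrite mul1r ger0_norm//; lra.
  by rewrite (ger0_norm x0) ler_norm.
rewrite ltr0_norm// in hx; apply: (main (- 1) (- rad) rad).
- move=> y; rewrite in_itv/= => /andP[y1 y2]; rewrite mulN1r ler0_norm//; lra.
- by rewrite !mulN1r opprK addrC.
- by rewrite (ltr0_norm x0) -normrN (le_trans _ (ler_norm _))//; lra.
Qed.

(** Keeping (|x| - rad)^2 in the exponent serves both forms of (e): the asymptotic one directly, and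
    the explicit one by comparison of the exponentials. *)
Lemma heat_conv_tail (p x : R) : 1 < p -> F \in Lfun mu p%:E -> 2 * rad <= `|x| ->
  `|heat_conv F t x| <= M_const p * fine (Lp_norm p%:E F) *
    (`|x| `^ p^-1 * expR (- (`|x| - rad) ^+ 2 / (4 * t)) * t `^ (- (2^-1 + p^-1))).
Proof.
move=> p1 FL hx; have p0 : 0 < p by apply: lt_trans p1.
have [mF iF] := Lfun_integral_powR (ltW p1) FL.
have kAB := kernel_bound_derive1_heat_kernel t0.
have mK : measurable_fun setT (fun y : R => K (x - y)).
  exact: measurable_shift (kernel_cont kAB).
have NE : Lp_norm p%:E F = (fine (Lp_norm p%:E F))%:E by rewrite fineK ?Lfun_norm_fin// ltW.
set N := fine _ in iF NE *.
have N0 : 0 <= N by rewrite fine_ge0 ?Lnorm_ge0.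
pose q := p / (p - 1).
have pm1 : 0 < p - 1 by rewrite subr_gt0.
have q0 : 0 < q by rewrite divr_gt0.
have pq : p^-1 + q^-1 = 1 by rewrite /q; field; rewrite !gt_eqF.
have q1 : 1 <= q by rewrite ler_pdivlMr// mul1r gerBl.
have mI : measurable I by exact: measurable_itv.
(* F vanishes almost everywhere off [-rad, rad], so the kernel may be cut off there before Hoelder's
   inequality. *)
pose h y := K (x - y) * \1_I y.
have mh : measurable_fun setT h by apply: measurable_funM => //; exact: measurable_indic.
pose z := `|x| - rad.
pose B := C `^ q * ((3 / 2 * `|x|) `^ (q - 1) * (2 * t / q * expR (- (q * z ^+ 2 / (4 * t))))).
have Nh : (\int[mu]_y (`|h y| `^ q)%:E <= B%:E)%E.
  apply: (@le_trans _ _ (\int[mu]_(y in I) ((C `^ q * (3 / 2 * `|x|) `^ (q - 1))%:E *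
      (`|x - y| * expR (- (q * (x - y) ^+ 2 / (4 * t))))%:E))%E).
    rewrite [leRHS]integral_mkcond; apply: ge0_le_integral => //.
    - apply/measurable_EFinP; apply: (measurableT_comp (measurable_powR q)).
      exact: measurableT_comp.
    - apply/(measurable_restrictT _ mI); apply: emeasurable_funM => //.
      apply/measurable_EFinP; apply: measurable_funTS; apply: measurable_funM.
        by apply: measurableT_comp => //; exact: measurable_funB.
      apply: measurableT_comp => //; apply: measurableT_comp => //.
      apply: measurable_funM => //; apply: measurable_funM => //.
      by apply: measurable_funX; exact: measurable_funB.
    - move=> y _; rewrite patchE /h indicE; case: ifPn => yI; last first.
        by rewrite mulr0 normr0 powR0// gt_eqF.
      rewrite mulr1 -EFinM lee_fin normr_K.
      move: yI; rewrite inE /I/= in_itv/= -ler_norml => yr.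
      have u1 : `|x - y| <= 3 / 2 * `|x|.
        by apply: (le_trans (ler_normB _ _)); lra.
      have E0 : 0 <= expR (- ((x - y) ^+ 2 / (4 * t))) by exact: expR_ge0.
      rewrite (powRM _ (ltW C0) (mulr_ge0 (normr_ge0 _) E0)) (powRM _ (normr_ge0 _) E0).
      have -> : expR (- ((x - y) ^+ 2 / (4 * t))) `^ q = expR (- (q * (x - y) ^+ 2 / (4 * t))).
        by rewrite -expRM; congr expR; ring.
      rewrite -[leRHS]mulrA ler_wpM2l ?powR_ge0// [leRHS]mulrA ler_wpM2r ?expR_ge0//.
      rewrite -(mulr_powRB1 (normr_ge0 _) q0) mulrC ler_wpM2r//.
      by rewrite ge0_ler_powR ?nnegrE ?subr_ge0// mulr_ge0.
  rewrite ge0_integralZl_EFin; first last.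
  - by rewrite mulr_ge0 ?powR_ge0.
  - apply/measurable_EFinP; apply: measurable_funTS; apply: measurable_funM.
      by apply: measurableT_comp => //; exact: measurable_funB.
    apply: measurableT_comp => //; apply: measurableT_comp => //.
    apply: measurable_funM => //; apply: measurable_funM => //.
    by apply: measurable_funX; exact: measurable_funB.
  - by move=> y _; rewrite lee_fin mulr_ge0 ?expR_ge0.
  - exact: mI.
  rewrite /B mulrA [leRHS]EFinM lee_wpmul2l ?lee_fin ?mulr_ge0 ?powR_ge0//.
  exact: integral_gauss_moment.
have B0 : 0 <= B.
  apply: mulr_ge0; first exact: powR_ge0.
  apply: mulr_ge0; first exact: powR_ge0.
  apply: mulr_ge0; last exact: expR_ge0.
  by apply: divr_ge0 (ltW q0); rewrite mulr_ge0 ?(ltW t0).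
have Nq : (Lp_norm q%:E h <= (B `^ q^-1)%:E)%E.
  rewrite Lp_normE -poweR_EFin; apply: gt0_ler_poweR Nh; first by rewrite invr_ge0 ltW.
  - rewrite in_itv/= leey andbT.
    by apply: integral_ge0 => y _; rewrite lee_fin powR_ge0.
  - by rewrite in_itv/= leey andbT lee_fin.
have bd : (\int[mu]_y (`|F y * K (x - y)|)%:E <= (N * B `^ q^-1)%:E)%E.
  apply: (@le_trans _ _ (Lp_norm p%:E F * Lp_norm q%:E h)%E); last first.
    by rewrite NE [leRHS]EFinM lee_wpmul2l ?lee_fin.
  apply: le_trans (hoelder mu mF mh p0 q0 pq).
  rewrite Lnorm1; apply: ae_ge0_le_integral => //.
  - apply/measurable_EFinP; apply: measurableT_comp => //; exact: measurable_funM.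
  - apply/measurable_EFinP; apply: measurableT_comp => //; exact: measurable_funM.
  - have [Z [mZ Z0 sub]] := Fsupp; exists Z; split => // y /= hy.
    apply: sub => /= Fy; apply: hy => _; rewrite lee_fin.
    have [/Fy ->|yr] := ltP rad `|y|; first by rewrite !mul0r.
    by rewrite /h indicE mem_set ?mulr1// /I/= in_itv/= -ler_norml.
apply: (le_trans (normr_conv_le mF mK bd).2).
rewrite [leRHS](_ : _ = N * (M_const p * (`|x| `^ p^-1 * expR (- z ^+ 2 / (4 * t)) *
  t `^ (- (2^-1 + p^-1))))); last by rewrite /z; ring.
rewrite (ler_wpM2l N0)// -(tail_constantE _ p1 t0 (normr_ge0 x)) /B /C.
by have -> : q * (- z ^+ 2 / (4 * t)) = - (q * z ^+ 2 / (4 * t)) by ring.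
Qed.
End tail.

Theorem theorem3p1 (R : realType) (p : R) (hp : 1 <= p) :
  let mu := @lebesgue_measure R in
  (* (a) *)
  (forall q r : \bar R, (1 <= q)%E -> (1 <= r)%E ->
     (p%:E^-1 + q^-1 = 1 + r^-1)%E ->
     let rate (t : R) := t `^ (- ((2 - fine q^-1%E) / 2)) in
     (exists L : R, forall (f : (R -> R) -> R) (F : R -> R),
        Lprime p%:E f -> primitive p%:E f F ->
        forall t : R, 0 < t ->
          (Lp_norm r (heat_conv F t) <= L%:E * Lp_norm p%:E F * (rate t)%:E)%E)
     /\
     (forall psi : R -> R, (forall t, 0 < t -> 0 < psi t) ->
        (littleo_near 0^'+ psi rate ->
           exists (g : (R -> R) -> R) (G : R -> R),
             [/\ Lprime p%:E g, primitive p%:E g G &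
                 unbounded_near 0^'+
                   (fun t => Lp_norm r (heat_conv G t) / (psi t)%:E)%E])
        /\
        (littleo_near +oo psi rate ->
           exists (g : (R -> R) -> R) (G : R -> R),
             [/\ Lprime p%:E g, primitive p%:E g G &
                 unbounded_near +oo
                   (fun t => Lp_norm r (heat_conv G t) / (psi t)%:E)%E])))
  /\
  forall (f : (R -> R) -> R) (F : R -> R),
  Lprime p%:E f -> primitive p%:E f F ->
  forall t : R, 0 < t ->
  let v := heat_conv F t in
  [/\ (* (b) *)
      ~ of_one_sign v,
      (* (c) *)
      [/\ (fun ab : R * R => (\int[mu]_(x in `[ab.1, ab.2]) v x)%R)
            @ filter_prod -oo +oo --> (0 : R),
          mu.-integrable setT (EFin \o v) ->
            (\int[mu]_x (v x)%:E = 0)%E &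
          p = 1 -> mu.-integrable setT (EFin \o v)],
      (* (d) *)
      v x @[x --> +oo] --> (0 : R) /\ v x @[x --> -oo] --> (0 : R) &
      (* (e) *)
      forall rad : R, 0 <= rad -> dist_support f `<=` `[- rad, rad] ->
      let bound (x : R) :=
        `|x| `^ p^-1 * expR (- (`|x| - rad) ^+ 2 / (4 * t)) in
      [/\ bigO_near +oo v bound,
          bigO_near -oo v bound,
          p = 1 -> forall x, rad + Num.sqrt (2 * t) <= `|x| ->
            (`|v x|%:E <= (M_const p)%:E * Lp_norm 1 F *
               (`|x| * expR (- (`|x| - rad) ^+ 2 / (4 * t))
                * t `^ (- (3 / 2)))%:E)%E &
          1 < p -> forall x, 2 * rad <= `|x| ->
            (`|v x|%:E <= (M_const p)%:E * Lp_norm p%:E F *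
               (`|x| `^ p^-1 * expR (- x ^+ 2 / (16 * t))
                * t `^ (- (2^-1 + p^-1)))%:E)%E]].
Proof.
move=> mu; split.
  move=> q r q1 r1 pqr rate; split.
    eexists => f F _ [FLp _] t t0; exact: (heat_conv_upper hp q1 r1 pqr FLp t0).
  move=> psi psi0; split => o.
    exact: (heat_conv_rate_sharp_at_right0 hp q1 r1 pqr psi0 o).
  exact: (heat_conv_rate_sharp_pinfty hp q1 r1 pqr psi0 o).
move=> f F _ pF t t0 v; have [FLp _] := pF; split.
- exact: (heat_conv_not_one_sign hp FLp t0).
- split.
  + exact: (heat_conv_mean_zero hp FLp t0).
  + exact: (heat_conv_integral_eq0 hp FLp t0).
  + exact: (heat_conv_integrable hp FLp t0).
- exact: (vanishing_cvg (heat_conv_vanishing hp FLp t0)).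
move=> rad rad0 supp bound.
have Fsupp := primitive_eq0_off_support hp pF rad0 supp.
have p0 : 0 < p by apply: lt_le_trans hp.
have bound_ge0 x : 0 <= bound x by rewrite mulr_ge0 ?powR_ge0 ?expR_ge0.
have NE : Lp_norm p%:E F = (fine (Lp_norm p%:E F))%:E.
  by rewrite fineK// Lfun_norm_fin.
have N0 : 0 <= fine (Lp_norm p%:E F) by rewrite fine_ge0// Lnorm_ge0.
(* One threshold on |x| covers both ends of the line: rad + sqrt (2t) for p = 1 and 2 rad for p > 1.
   The powers of t go into C. *)
have [C [X hC]] : exists C X : R, forall x, X <= `|x| -> `|v x| <= C * `|bound x|.
  have [p1|p1] := eqVneq p 1.
    exists ((4 * Num.sqrt pi)^-1 * fine (Lp_norm p%:E F) * t `^ (- (3 / 2))).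
    exists (rad + Num.sqrt (2 * t)) => x hx.
    move: FLp; rewrite p1 => FL1.
    apply: (le_trans (heat_conv_tail1 t0 rad0 Fsupp FL1 hx)).
    rewrite (ger0_norm (bound_ge0 x)) /bound p1 invr1 powRr1// le_eqVlt; apply/orP; left; apply/eqP.
    by move: (fine _) (expR _) (_ `^ _) => a b c; ring.
  have {}p1 : 1 < p by rewrite lt_neqAle eq_sym p1.
  exists (M_const p * fine (Lp_norm p%:E F) * t `^ (- (2^-1 + p^-1))).
  exists (2 * rad) => x hx.
  apply: (le_trans (heat_conv_tail t0 rad0 Fsupp p1 FLp hx)).
  rewrite (ger0_norm (bound_ge0 x)) /bound le_eqVlt; apply/orP; left; apply/eqP.
  by move: (fine _) (M_const _) (expR _) (_ `^ _) (_ `^ _) => a b c d e; ring.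
split.
- exists C, X; split; first exact: num_real.
  by move=> x Xx; apply: hC; rewrite (le_trans (ltW Xx))// ler_norm.
- exists C, (- X); split; first exact: num_real.
  by move=> x Xx; apply: hC; rewrite -normrN (le_trans _ (ler_norm _))// lerNr ltW.
- move=> p1 x hx; rewrite /M_const p1 eqxx; move: FLp NE; rewrite p1 => FL1 ->.
  by rewrite -!EFinM lee_fin; exact: (heat_conv_tail1 t0 rad0 Fsupp FL1 hx).
- move=> p1 x hx; rewrite NE -!EFinM lee_fin.
  apply: (le_trans (heat_conv_tail t0 rad0 Fsupp p1 FLp hx)).
  have M0 : 0 <= M_const p.
    by rewrite /M_const (gt_eqF p1) divr_ge0 ?mulr_ge0 ?powR_ge0 ?sqrtr_ge0.
  rewrite ler_wpM2l ?mulr_ge0// ler_wpM2r ?powR_ge0// ler_wpM2l ?powR_ge0//.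
  rewrite ler_expR !mulNr lerN2.
  (* As |x| >= 2 rad, |x| - rad >= |x| / 2; halving |x| is what turns 4t into 16t. *)
  have -> : x ^+ 2 / (16 * t) = (`|x| / 2) ^+ 2 / (4 * t).
    by rewrite exprMn real_normK ?num_real//; field; rewrite gt_eqF.
  rewrite ler_wpM2r ?invr_ge0 ?mulr_ge0 ?(ltW t0)// ler_sqr ?nnegrE; lra.
Qed.
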